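(* Let $n\ge 2$ and $0\le a<1$. If $u\in C^2(\mathbb{R}^n)$ is positive and satisfies $\operatorname{div}(|x_n|^a\nabla u)=0$ in $\mathbb{R}^n$, then $u$ is a constant function.
   Context: Points of $\mathbb{R}^n$ are written $x=(x',x_n)$ with $x'\in\mathbb{R}^{n-1}$, $x_n\in\mathbb{R}$. The equation is understood in the sense of distributions on $\mathbb{R}^n$; since $u\in C^2(\mathbb{R}^n)$ this is equivalent to its holding pointwise at all points with $x_n\ne 0$. *)

(* Defs.v *)
From HB Require Import structures.
From mathcomp Require Import all_boot all_order all_algebra.
From mathcomp Require Import all_classical all_reals all_analysis.

Set Implicit Arguments.
Unset Strict Implicit.
Unset Printing Implicit Defensive.

Import Order.TTheory GRing.Theory Num.Theory.
Import numFieldNormedType.Exports.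

Local Open Scope classical_set_scope.
Local Open Scope ring_scope.

(* Lebesgue measure on R^n, carried by n.-tuple R with its product
   sigma-algebra (the library has it only for n = 1): a point mass for n = 0,
   and the image of lambda_1 \x lambda_n under (t, s) |-> t :: s for n + 1. *)
Section lebesgue_tuple.
Context {R : realType}.
Notation tupleR n := (n.-tuple (measurableTypeR R)).

Definition tuple_cons n (p : measurableTypeR R * tupleR n) : tupleR n.+1 :=
  [tuple of p.1 :: p.2].

Lemma measurable_tuple_cons n : measurable_fun setT (@tuple_cons n).
Proof. exact: measurable_cons measurable_fst measurable_snd. Qed.

Lemma measurable_tuple_uncons n :
  measurable_fun setT (fun t : tupleR n.+1 => (thead t, [tuple of behead t])).
Proof.
apply/measurable_fun_pairP; split.
  exact: measurable_tnth.
exact: measurable_behead.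
Qed.

Section step.
Variables (n : nat) (mu : {sigma_finite_measure set (tupleR n) -> \bar R}).

Definition lebesgue_step : set (tupleR n.+1) -> \bar R :=
  pushforward (lebesgue_measure \x mu)%E (@tuple_cons n).

Let step0 : lebesgue_step set0 = 0%E.
Proof. by rewrite /lebesgue_step /pushforward preimage_set0 measure0. Qed.

Let step_ge0 A : (0 <= lebesgue_step A)%E.
Proof. by rewrite /lebesgue_step /pushforward; exact: measure_ge0. Qed.

Let step_sigma_additive : semi_sigma_additive lebesgue_step.
Proof.
move=> F mF tF mUF; rewrite /lebesgue_step /pushforward preimage_bigcup.
apply: measure_semi_sigma_additive.
- by move=> k; rewrite -[X in measurable X]setTI; exact: measurable_tuple_cons.
- apply/trivIsetP => /= i j _ _ ij; rewrite -preimage_setI.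
  by move/trivIsetP : tF => /(_ _ _ _ _ ij) ->//; rewrite preimage_set0.
- rewrite -preimage_bigcup -[X in measurable X]setTI.
  exact: measurable_tuple_cons.
Qed.

HB.instance Definition _ := isMeasure.Build _ _ _
  lebesgue_step step0 step_ge0 step_sigma_additive.

Let step_sigma_finite : sigma_finite setT lebesgue_step.
Proof.
have /sigma_finiteP[F [TF ndF Foo]] := sigma_finiteT (@lebesgue_measure R).
have /sigma_finiteP[G [TG ndG Goo]] := sigma_finiteT mu.
pose uncons := fun t : tupleR n.+1 => (thead t, [tuple of behead t]).
have consK : cancel (@tuple_cons n) uncons.
  by move=> [x t]; rewrite /uncons /tuple_cons theadE; congr pair; apply/val_inj.
exists (fun k => uncons @^-1` (F k `*` G k)).
  rewrite -preimage_bigcup; apply/esym; rewrite -subTset => t _ /=.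
  have [i _ Fi] : (\bigcup_i F i) (thead t) by rewrite -TF.
  have [j _ Gj] : (\bigcup_i G i) [tuple of behead t] by rewrite -TG.
  exists (maxn i j) => //; split.
    by move: Fi; exact/subsetPset/ndF/leq_maxl.
  by move: Gj; exact/subsetPset/ndG/leq_maxr.
move=> k; have [mF Fk] := Foo k; have [mG Gk] := Goo k; split.
  rewrite -[X in measurable X]setTI; apply: measurable_tuple_uncons => //.
  exact: measurableX.
rewrite /lebesgue_step /pushforward -comp_preimage.
rewrite (_ : uncons \o _ = id) ?preimage_id; last first.
  by apply/funext => p; exact: consK.
by rewrite product_measure1E// lte_mul_pinfty// ge0_fin_numE.
Qed.

HB.instance Definition _ := Measure_isSigmaFinite.Build _ _ _
  lebesgue_step step_sigma_finite.

End step.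

Fixpoint lebesgue_tuple n : {sigma_finite_measure set (tupleR n) -> \bar R} :=
  match n with
  | 0 => \d_([tuple] : tupleR 0)
  | m.+1 => lebesgue_step (lebesgue_tuple m)
  end.

End lebesgue_tuple.

Section calculus.
Context {R : realType} {n : nat}.
Implicit Types (f phi : 'rV[R]_n -> R) (F : 'rV[R]_n -> 'rV[R]_n).

Definition partial (i : 'I_n) f : 'rV[R]_n -> R :=
  fun x => 'D_(delta_mx 0 i) f x.

Definition grad f : 'rV[R]_n -> 'rV[R]_n := fun x => \row_i partial i f x.

Fixpoint class_C (k : nat) f : Prop :=
  match k with
  | 0 => continuous f
  | k'.+1 => continuous f /\
      forall i, (forall x, derivable f x (delta_mx 0 i)) /\
                class_C k' (partial i f)
  end.

Definition test_function phi : Prop :=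
  (forall k, class_C k phi) /\ compact (closure [set x | phi x != 0]).

Definition dot (v w : 'rV[R]_n) : R := \sum_i v 0 i * w 0 i.

Definition integral_Rn f : \bar R :=
  (\int[lebesgue_tuple n]_t (f (\row_i tnth t i))%:E)%E.

(* the pairing < div F, phi > = - \int F . grad phi, meaningful for F in
   L^1_loc and phi a test function *)
Definition distr_div F phi : \bar R :=
  (- integral_Rn (fun x => (dot (F x) (grad phi x))%R))%E.

End calculus.

(* Main.v *)
Require Import Defs.
From mathcomp Require Import all_boot all_order all_algebra.
From mathcomp Require Import ring lra.
From mathcomp Require Import all_classical all_reals all_analysis.
From mathcomp Require Import measurable_realfun.

(** The weighted operator is homogeneous, and this gives u a mean value
property that turns Liouville's classical argument into one for the weight.

Let n be the dimension, N = n + a, and let y be a point of {x_n = h}, where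
h = 0 if a > 0 and h is arbitrary if a = 0. Write r = T - |x - y|^2,
tau = x_n - h and t_+ = max (t, 0). A direct computation expresses
|x_n|^(-a) div (|x_n|^a grad (tau^(2k) r_+^p)) as a linear combination of
tau^(2k-2) r_+^p, tau^(2k) r_+^(p-1) and tau^(2k) r_+^(p-2). Tested against u,
this is a linear relation between the moments
J_(k,q) (T) = \int u |x_n|^a tau^(2k) r_+^q  (lemma moment_relation).

For k = 0 the relation reads q T J_(0,q-1) = (q + N/2) J_(0,q). As the
derivative of J_(0,q) is q J_(0,q-1), it is an Euler equation, so that
J_(0,q) (T) = gamma T^(q + N/2) (radial_law). The number gamma stands for the
value of u at the center. Since u is positive and large balls around two
centers nearly coincide, gamma does not depend on the center (moment_center).
Comparing with the function 1 gives a constant c such that all the moments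
J_(0,q) of v = u - c vanish, around every center.

For k > 0, assume that the moments of v of order k - 1 vanish. The relation is
then an Euler equation again, and J_(k,q) (T) is a multiple of
T^(q + N/2 + 2k). But tau^2 <= T on the support of r_+, which bounds J_(k,q) by
a multiple of T^(q + N/2 + k). Letting T grow, J_(k,q) = 0
(moment_vanish_step). So all the moments vanish (moments_vanish).

If a = 0, each point is a center; the moments with k = 0 over small balls show
that v vanishes there (nonpos_of_radial). If a > 0, the centers are only the
points of {x_n = 0}, but the weight vanishes on this hyperplane: no flux goes
through it, the previous argument works on each of the half-spaces
{x_n > 0} and {x_n < 0} separately, and there tau^(2k) concentrates, when k is
large, at the only point of the half-ball {r >= 0} that is farthest from the
hyperplane. This point being arbitrary, v = 0 (nonpos_of_moments). The
constants of the two half-spaces agree by continuity of u.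

The functions tau^(2k) r_+^p, cut off at the hyperplane, are not smooth. They
are limits of genuine test functions, built from exp (- eps / r) and
exp (- eps / |x_n|) (weak_limit). *)

Set Implicit Arguments.
Unset Strict Implicit.
Unset Printing Implicit Defensive.

Import Order.TTheory GRing.Theory Num.Theory.
Import numFieldNormedType.Exports.

Local Open Scope classical_set_scope.
Local Open Scope ring_scope.

(** * Boxes and integrable functions on the space of tuples *)

Section tuple_measure.
Context {R : realType}.
Notation tupleR n := (n.-tuple (measurableTypeR R)).

Definition vec_of n (t : tupleR n) : 'rV[R]_n := \row_i tnth t i.

Lemma coord_le_norm n (x : 'rV[R]_n) i : `|x 0 i| <= `|x|.
Proof.
rewrite [leRHS]/Num.Def.normr /= mx_normrE.
by apply/bigmax_geP; right => /=; exists (0, i).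
Qed.

Lemma norm_lt_coord n (x : 'rV[R]_n) e : 0 < e ->
  (forall i, `|x 0 i| < e) -> `|x| < e.
Proof.
move=> e0 xe; rewrite [ltLHS]/Num.Def.normr /= mx_normrE.
by apply/bigmax_ltP; split => //= -[i j] _ /=; rewrite ord1.
Qed.

Lemma norm_le_coord n (x : 'rV[R]_n) e : 0 <= e ->
  (forall i, `|x 0 i| <= e) -> `|x| <= e.
Proof.
move=> e0 xe; rewrite [leLHS]/Num.Def.normr /= mx_normrE.
by apply/bigmax_leP; split => //= -[i j] _ /=; rewrite ord1.
Qed.

Definition box n (p : 'rV[R]_n) (e : R) : set (tupleR n) :=
  [set t | forall i, `|tnth t i - p 0 i| < e].

Lemma measurable_box n (p : 'rV[R]_n) e : measurable (box p e).
Proof.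
rewrite [X in measurable X](_ : _ =
    \bigcap_(i in [set: 'I_n])
      (@tnth _ (measurableTypeR R) ^~ i) @^-1` `](p 0 i - e), (p 0 i + e)[).
  apply: fin_bigcap_measurable => // i _.
  rewrite -[X in measurable X]setTI.
  by apply: (measurable_tnth i); [exact: measurableT|exact: measurable_itv].
apply/seteqP; split => t /= H i.
  by move=> _ /=; have := H i; rewrite in_itv/= ltr_norml; lra.
by have := H i I; rewrite /= in_itv/= ltr_norml; lra.
Qed.

Lemma lebesgue_box n (p : 'rV[R]_n) (e : R) : 0 < e ->
  (0 < lebesgue_tuple n (box p e) < +oo)%E.
Proof.
move=> e0; elim: n p => [|n IH] p.
  rewrite /= diracE mem_set ?lte01 ?ltry//.
  by move=> [].
have := IH (\row_i p 0 (lift ord0 i)).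
set b := box _ _ => /andP[b0 boo].
(* The box is the product of its first side and of a box of lower dimension. *)
pose I0 : set (measurableTypeR R) := `](p 0 ord0 - e), (p 0 ord0 + e)[%classic.
have -> : lebesgue_tuple n.+1 (box p e) =
   (lebesgue_measure I0 * lebesgue_tuple n b)%E.
  rewrite -product_measure1E; [|exact: measurable_itv|exact: measurable_box].
  rewrite /= /lebesgue_step /pushforward; congr (_ _).
  apply/seteqP; split => [[t s]|[t s]] /=.
    move=> H; split => /=.
      by have := H ord0; rewrite /I0/= in_itv/= /tuple_cons/= ltr_norml (tnth_nth 0)/=; lra.
    by move=> i; have := H (lift ord0 i); rewrite mxE /tuple_cons/= !(tnth_nth 0) /=.
  rewrite /I0/= in_itv/= => -[H1 H2] i.
  case: (unliftP ord0 i) => [j|] ->.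
    by have := H2 j; rewrite mxE /tuple_cons/= !(tnth_nth 0) /=.
  by rewrite /tuple_cons/= ltr_norml (tnth_nth 0)/=; lra.
rewrite /I0 lebesgue_measure_itv/= lte_fin ifT; last by lra.
rewrite -EFinB; apply/andP; split.
  by rewrite mule_gt0// lte_fin; lra.
by rewrite lte_mul_pinfty// ?lee_fin; lra.
Qed.

(** Open sets of R^n are countable unions of boxes with rational center and
radius, and boxes are in the product sigma-algebra. *)
Lemma measurable_vec_of n (f : 'rV[R]_n -> R) : continuous f ->
  measurable_fun setT (fun t : tupleR n => f (vec_of t)).
Proof.
move=> cf; apply: (measurability _ (RGenOInfty.measurableE R)) => //.
move=> /= _ [_ [a ->] <-]; rewrite setTI.
(* P q: the box with center q.1 and radius q.2 is mapped into ]a, +oo[. *)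
pose P (q : 'rV[rat]_n * rat) := 0 < ratr q.2 :> R /\
  forall x : 'rV[R]_n, (forall i, `|x 0 i - ratr (q.1 0 i)| < ratr q.2) -> a < f x.
rewrite [X in measurable X](_ : _ =
    \bigcup_(q in P) box (\row_i ratr (q.1 0 i)) (ratr q.2)).
  rewrite bigcup_mkcond; apply: countable_bigcupT_measurable => // q.
  by case: ifP => _; [exact: measurable_box|exact: measurable0].
apply/seteqP; split => t /=; last first.
  move=> [q [q0 Pq] Bq]; rewrite in_itv/= andbT; apply: Pq => i.
  by have := Bq i; rewrite !mxE.
rewrite in_itv/= andbT => at0.
have : \forall x \near vec_of t, a < f x.
  exact: (cvgr_gt (f (vec_of t)) (cf (vec_of t)) _ at0).
move=> /nbhs_ballP[e /= e0 He].
have [r] := rat_in_itvoo (divr_gt0 e0 (ltr0Sn _ 1)).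
rewrite in_itv/= => /andP[r0 re].
have /choice[q Hq] : forall i, exists q : rat,
    `|tnth t i - ratr q| < ratr r.
  move=> i; have : tnth t i - ratr r < tnth t i + ratr r :> R by lra.
  move=> /rat_in_itvoo[q]; rewrite in_itv/= => Hq; exists q.
  by rewrite ltr_norml; lra.
exists (\row_i q i, r); last first.
  by move=> i; rewrite /= !mxE.
split => //= x Hx; apply: He; rewrite -ball_normE /=.
apply: norm_lt_coord => // i; rewrite !mxE.
have := Hx i; have := Hq i; rewrite !mxE /=.
have tri (b c d : R) : `|b - d| < ratr r -> `|c - d| < ratr r -> `|b - c| < e.
  by rewrite !ltr_norml; lra.
exact: tri.
Qed.

Definition Cc n (f : 'rV[R]_n -> R) : Prop :=
  continuous f /\ exists B, forall x, B < `|x| -> f x = 0.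

(** Bound and support are taken with the same radius, so that they can be used
together. *)
Lemma Cc_bounded n (f : 'rV[R]_n -> R) : Cc f ->
  exists B C, [/\ 0 < B, 0 < C, forall x, `|f x| <= C &
    forall x, B <= `|x| -> f x = 0].
Proof.
move=> [cf [B0 fB0]]; pose B := `|B0| + 1.
have Bp : 0 < B by rewrite /B ltr_wpDl.
have cK : compact [set x : 'rV[R]_n | `|x| <= B].
  apply: bounded_closed_compact.
    exists B; split; first exact: num_real.
    by move=> M BM x /= xB; apply: le_trans xB (ltW BM).
  apply: (@closed_comp _ _ (fun x : 'rV[R]_n => `|x|) [set y | y <= B]).
    by move=> x _; exact: norm_continuous.
  exact: closed_le.
have [||c Kc Hc] := EVT_max_rV (f := fun x => `|f x|) _ cK.
- by exists 0 => /=; rewrite normr0 ltW.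
- apply: continuous_subspaceT => x.
  by apply: continuous_comp; [exact: cf|exact: norm_continuous].
have f0 x : B <= `|x| -> f x = 0.
  move=> xB; apply: fB0; apply: lt_le_trans xB; rewrite /B.
  by rewrite (le_lt_trans (ler_norm _))// ltrDl.
exists B, (`|f c| + 1); split; [exact: Bp|by rewrite ltr_wpDl| |exact: f0].
move=> x; have [xB|Bx] := leP `|x| B.
  by apply: (le_trans (Hc x _)); [rewrite inE|rewrite lerDl].
by rewrite f0 ?(ltW Bx)// normr0 addr_ge0.
Qed.

Lemma Cc_integrable n (f : 'rV[R]_n -> R) : Cc f ->
  (lebesgue_tuple n).-integrable setT (fun t => (f (vec_of t))%:E).
Proof.
move=> Cf; have [B [C [B0 C0 fC fB]]] := Cc_bounded Cf.
have mf := measurable_vec_of Cf.1.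
pose b := box (0 : 'rV[R]_n) B.
apply: (@le_integrable _ _ _ (lebesgue_tuple n) setT measurableT _
   (fun t => C%:E * (\1_b t)%:E)%E).
- exact/measurable_EFinP.
- move=> t _; rewrite /= lee_fin; have [tb|tb] := boolP (t \in b).
    by rewrite indicE tb mulr1 (ger0_norm (ltW C0)).
  rewrite fB ?normr0//.
  rewrite leNgt; apply: contra tb => tb; rewrite inE => i.
  rewrite mxE subr0; apply: le_lt_trans tb.
  by have := coord_le_norm (vec_of t) i; rewrite mxE.
- have mb : measurable b by exact: measurable_box.
  apply: integrableZl => //; apply/integrableP; split.
    by apply/measurable_EFinP; exact: measurable_indic.
  rewrite (eq_integral (fun t => (\1_b t)%:E)); last first.
    by move=> t _; rewrite gee0_abs// lee_fin.
  rewrite integral_indic// setIT.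
  by have /andP[] := lebesgue_box (0 : 'rV[R]_n) B0.
Qed.

End tuple_measure.

(** * Derivatives along lines and the integral of a partial derivative *)

Section calculus_lines.
Context {R : realType}.

(** Directional derivatives only see the function on a line: they can be
transported along any map that sends lines to lines affinely, here the slices
of R^(n+1) and the parametrizations of lines. *)
Lemma is_derive_affine (U V : normedModType R) (f : V -> R) (L : U -> V)
    (x v : U) (v' : V) (df : R) :
  (forall h : R, L (h *: v + x) = h *: v' + L x) ->
  is_derive (L x) v' f df -> is_derive x v (f \o L) df.
Proof.
move=> HL [Df df_]; have E : (fun h : R => h^-1 *: ((f \o L) (h *: v + x) - (f \o L) x)) =
  (fun h : R => h^-1 *: (f (h *: v' + L x) - f (L x))).
  by apply/funext => h /=; rewrite HL.
by split; [move: Df; rewrite /derivable /comp -E|rewrite -df_ /derive /comp -E].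
Qed.

Lemma is_derive_line (V : normedModType R) (f : V -> R) (x v : V) (df : R) :
  is_derive x v f df <-> is_derive (0 : R) (1 : R) (fun h : R => f (h *: v + x)) df.
Proof.
split=> H.
  apply: (@is_derive_affine _ _ f (fun h : R => h *: v + x) 0 1 v) => [h|].
    by rewrite scale0r add0r addr0 [_ *: 1]mulr1.
  by rewrite scale0r add0r.
have E : (fun h : R => h^-1 *: (f (h *: v + x) - f x)) =
  (fun h : R => h^-1 *: (f ((h *: (1 : R) + 0 : R) *: v + x) - f ((0 : R) *: v + x))).
  by apply/funext => h; rewrite [_ *: 1]mulr1 addr0 scale0r add0r.
case: H => Df df_.
by split; [move: Df; rewrite /derivable -E|rewrite -df_ /derive -E].
Qed.

(** The chain rule is applied on the line through x directed by v, where f has an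
ordinary derivative. *)
Lemma is_derive_chain (V : normedModType R) (f : V -> R) (g : R -> R) (x v : V)
    (df dg : R) : is_derive x v f df -> is_derive (f x) (1 : R) g dg ->
  is_derive x v (fun z => g (f z)) (dg * df).
Proof.
move=> /is_derive_line Hf Hg; apply/is_derive_line.
apply: (@is_derive1_comp _ g (fun h : R => f (h *: v + x)) 0 dg df) => //.
by rewrite /= scale0r add0r.
Qed.

Lemma is_derive_continuous1 (f : R -> R) (x df : R) :
  is_derive x (1 : R) f df -> {for x, continuous f}.
Proof. by move=> [Df _]; exact/differentiable_continuous/derivable1_diffP. Qed.

Lemma continuous_dist (V : normedModType R) (f : V -> R) (x : V) :
  {for x, continuous f} -> forall e, 0 < e ->
  exists2 d, 0 < d & forall y, `|y - x| < d -> `|f y - f x| < e.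
Proof.
move=> cf e e0.
have /cvgrPdist_lt/(_ _ e0)/nbhs_ballP[d /= d0 Hd] : f y @[y --> x] --> f x.
  exact: cf.
exists d => // y yx; rewrite distrC; apply: Hd.
by rewrite -ball_normE /= distrC.
Qed.

Lemma dist_continuous (V : normedModType R) (f : V -> R) (x : V) :
  (forall e, 0 < e ->
    exists2 d, 0 < d & forall y, `|y - x| < d -> `|f y - f x| < e) ->
  {for x, continuous f}.
Proof.
move=> H; apply/cvgrPdist_lt => e /H[d d0 Hd].
apply/nbhs_ballP; exists d => //= y; rewrite -ball_normE /= => yx.
by rewrite distrC; apply: Hd; rewrite distrC.
Qed.

End calculus_lines.

Section slices.
Context {R : realType}.

(** Counterpart on row vectors of the decomposition of the Lebesgue measure of
R^(n+1), which splits off the first coordinate. *)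
Definition consr n (t : R) (s : 'rV[R]_n) : 'rV[R]_n.+1 :=
  \row_i if unlift ord0 i is Some j then s 0 j else t.

Lemma consr0 n t (s : 'rV[R]_n) : consr t s 0 ord0 = t.
Proof. by rewrite mxE unlift_none. Qed.

Lemma consrS n t (s : 'rV[R]_n) j : consr t s 0 (lift ord0 j) = s 0 j.
Proof. by rewrite mxE liftK. Qed.

Lemma consrB n t t' (s s' : 'rV[R]_n) :
  consr t s - consr t' s' = consr (t - t') (s - s').
Proof.
apply/rowP => i; case: (unliftP ord0 i) => [j|] ->.
  by rewrite !mxE !liftK !mxE.
by rewrite !mxE !unlift_none.
Qed.

Lemma consr_add_delta0 n h t (s : 'rV[R]_n) :
  consr (h + t) s = h *: delta_mx 0 ord0 + consr t s.
Proof.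
apply/rowP => i; case: (unliftP ord0 i) => [j|] ->.
  by rewrite !mxE !liftK /= mulr0 add0r.
by rewrite !mxE !unlift_none /= mulr1.
Qed.

Lemma consr_add_deltaS n h t (s : 'rV[R]_n) j :
  consr t (h *: delta_mx 0 j + s) = h *: delta_mx 0 (lift ord0 j) + consr t s.
Proof.
apply/rowP => i; case: (unliftP ord0 i) => [k|] ->.
  by rewrite !mxE !liftK !mxE /= (inj_eq lift_inj).
by rewrite !mxE !unlift_none /= mulr0 add0r.
Qed.

Lemma norm_consr n t (s : 'rV[R]_n) : `|consr t s| = Num.max `|t| `|s|.
Proof.
apply/eqP; rewrite eq_le; apply/andP; split.
  apply: norm_le_coord => [|i]; first by rewrite le_max normr_ge0.
  case: (unliftP ord0 i) => [j|] ->.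
    by rewrite consrS le_max coord_le_norm orbT.
  by rewrite consr0 le_max lexx.
rewrite ge_max; apply/andP; split.
  by have := coord_le_norm (consr t s) ord0; rewrite consr0.
apply: norm_le_coord => // j.
by have := coord_le_norm (consr t s) (lift ord0 j); rewrite consrS.
Qed.

Lemma continuous_consr_l n (f : 'rV[R]_n.+1 -> R) s : continuous f ->
  continuous (fun t => f (consr t s)).
Proof.
move=> cf t; apply: dist_continuous => e /(continuous_dist (cf (consr t s)))[d d0 H].
by exists d => // y yt; apply: H; rewrite consrB norm_consr subrr normr0 gt_max yt d0.
Qed.

Lemma continuous_consr_r n (f : 'rV[R]_n.+1 -> R) t : continuous f ->
  continuous (fun s => f (consr t s)).
Proof.
move=> cf s; apply: dist_continuous => e /(continuous_dist (cf (consr t s)))[d d0 H].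
by exists d => // y ys; apply: H; rewrite consrB norm_consr subrr normr0 gt_max d0 ys.
Qed.

Lemma vec_of_cons n (t : measurableTypeR R) (s : n.-tuple (measurableTypeR R)) :
  vec_of (tuple_cons (t, s)) = consr t (vec_of s).
Proof.
apply/rowP => i; case: (unliftP ord0 i) => [j|] ->.
  by rewrite consrS !mxE !(tnth_nth 0).
by rewrite consr0 !mxE !(tnth_nth 0).
Qed.

End slices.

Section integral_derivative.
Context {R : realType}.

Lemma integral_derivative1 (f g : R -> R) (B : R) : continuous g ->
  (forall x, is_derive x (1 : R) f (g x)) ->
  (forall x, B < `|x| -> f x = 0) -> (forall x, B < `|x| -> g x = 0) ->
  (\int[lebesgue_measure]_x (g x)%:E = 0)%E.
Proof.
move=> cg df f0 g0.
(* The segment strictly contains the support, so f vanishes at its ends. *)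
pose b : R := `|B| + 1.
have Bb : B < b by rewrite /b (le_lt_trans (ler_norm _))// ltrDl.
have b0 : 0 < b by rewrite /b ltr_wpDl.
have cf x : {for x, continuous f} by exact: is_derive_continuous1 (df x).
pose I : set R := `[(- b), b]%classic.
transitivity (\int[lebesgue_measure]_(x in I) (g x)%:E)%E.
  rewrite [RHS]integral_mkcond; apply: eq_integral => x _.
  rewrite patchE; case: ifPn => //; rewrite notin_setE /I /= in_itv /=.
  rewrite -ler_norml => /negP; rewrite -ltNge => bx.
  by rewrite g0// (lt_trans Bb).
rewrite (@continuous_FTC2 _ g f); first last.
- by move=> x _; rewrite derive1E; apply: derive_val.
- split.
  + by move=> x _; exact: ex_derive.
  + by apply: cvg_at_right_filter; exact: cf.
  + by apply: cvg_at_left_filter; exact: cf.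
- exact: continuous_subspaceT.
- by lra.
by rewrite !f0 ?subee// ?normrN gtr0_norm.
Qed.

(** The Lebesgue measure of R^(n+1) is by definition an image measure; the
integral is pulled back to the product, where Fubini applies. *)
Lemma integral_tuple_cons n (f : 'rV[R]_n.+1 -> R) : Cc f ->
  let F := fun p : measurableTypeR R * n.-tuple (measurableTypeR R) =>
    (f (consr p.1 (vec_of p.2)))%:E in
  ((lebesgue_measure \x lebesgue_tuple n)%E.-integrable setT F /\
  integral_Rn f = \int[(lebesgue_measure \x lebesgue_tuple n)%E]_p F p)%E.
Proof.
move=> Cf F; have If := Cc_integrable Cf.
have mf : measurable_fun setT (fun t : n.+1.-tuple (measurableTypeR R) => (f (vec_of t))%:E).
  by case/integrableP : If.
have FE : F = (fun t : n.+1.-tuple (measurableTypeR R) => (f (vec_of t))%:E) \o @tuple_cons R n.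
  by apply/funext => -[t s]; rewrite /F /= vec_of_cons.
have mc := @measurable_tuple_cons R n.
have IF : (lebesgue_measure \x lebesgue_tuple n)%E.-integrable setT F.
  apply/integrableP; split; first by rewrite FE; exact: measurableT_comp.
  have /integrableP[_] := If; apply: le_lt_trans.
  rewrite le_eqVlt; apply/orP; left; apply/eqP.
  transitivity (\int[pushforward (lebesgue_measure \x lebesgue_tuple n) (@tuple_cons R n)]_t
     `|(f (vec_of t))%:E|)%E.
    rewrite ge0_integral_pushforward//; last exact: measurableT_comp.
    by rewrite preimage_setT FE.
  exact: eq_measure_integral.
split => //.
transitivity (\int[pushforward (lebesgue_measure \x lebesgue_tuple n) (@tuple_cons R n)]_t
     (f (vec_of t))%:E)%E.
  exact: eq_measure_integral.
rewrite integral_pushforward//.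
- by rewrite preimage_setT FE.
- by rewrite preimage_setT -FE.
Qed.

(** Integration by parts in its minimal form. If the derivative is taken along
the first coordinate, integrate first in this coordinate; if not, use the
induction hypothesis on the slices. *)
Lemma integral_partial n (i : 'I_n) (f g : 'rV[R]_n -> R) : Cc f -> Cc g ->
  (forall x, is_derive x (delta_mx 0 i) f (g x)) -> integral_Rn g = 0%E.
Proof.
elim: n i f g => [[]//|n IH] i f g Cf Cg df.
have [Ig ->] := integral_tuple_cons Cg.
have [[cf [Bf f0]] [cg [Bg g0]]] := (Cf, Cg).
case: (unliftP ord0 i) => [j|] iE.
  rewrite -integral12_prod_meas1//.
  rewrite integral0_eq// => t _; rewrite /fubini_F /=.
  apply: (IH j (fun s => f (consr t s)) (fun s => g (consr t s))).
  - split; first exact: continuous_consr_r.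
    by exists Bf => s Bs; apply: f0; rewrite norm_consr lt_max Bs orbT.
  - split; first exact: continuous_consr_r.
    by exists Bg => s Bs; apply: g0; rewrite norm_consr lt_max Bs orbT.
  - move=> s.
    apply: (@is_derive_affine _ _ _ f (consr t) s (delta_mx 0 j) (delta_mx 0 i)).
    by move=> h; rewrite iE consr_add_deltaS.
rewrite -integral21_prod_meas1//.
rewrite integral0_eq// => s _; rewrite /fubini_G /=.
apply: (@integral_derivative1 (fun t => f (consr t (vec_of s))) _ (Num.max Bf Bg)).
- exact: continuous_consr_l.
- move=> t.
  apply: (@is_derive_affine _ _ _ f (fun t => consr t (vec_of s)) t 1 (delta_mx 0 i)).
  by move=> h; rewrite iE -consr_add_delta0 [_ *: 1]mulr1.
- by move=> t; rewrite gt_max => /andP[Bt _]; apply: f0; rewrite norm_consr lt_max Bt.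
- by move=> t; rewrite gt_max => /andP[_ Bt]; apply: g0; rewrite norm_consr lt_max Bt.
Qed.

End integral_derivative.

(** * The integral as a functional; truncated powers and flat functions *)

Section derive_rules.
Context {R : realType} {V : normedModType R}.
Implicit Types (f g : V -> R) (x v : V).

Lemma is_derive_add f g x v df dg : is_derive x v f df -> is_derive x v g dg ->
  is_derive x v (fun z => f z + g z) (df + dg).
Proof. by move=> Hf Hg; exact: is_deriveD. Qed.

Lemma is_derive_mul f g x v df dg : is_derive x v f df -> is_derive x v g dg ->
  is_derive x v (fun z => f z * g z) (df * g x + f x * dg).
Proof.
move=> Hf Hg; have := is_deriveM Hf Hg.
rewrite -[_ *: dg]/(f x * dg) -[_ *: df]/(g x * df) => H.
by apply: (is_derive_eq H); rewrite addrC (mulrC df).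
Qed.

Lemma is_derive_mull c f x v df : is_derive x v f df ->
  is_derive x v (fun z => c * f z) (c * df).
Proof. by move=> Hf; exact: (is_deriveZ c Hf). Qed.

Lemma is_derive_pow f n x v df : is_derive x v f df ->
  is_derive x v (fun z => f z ^+ n) (n%:R * f x ^+ n.-1 * df).
Proof. by move=> Hf; have := is_deriveX n Hf; rewrite exprfctE. Qed.

Lemma is_derive_bigsum n (h : 'I_n -> V -> R) x v (dh : 'I_n -> R) :
  (forall i, is_derive x v (h i) (dh i)) ->
  is_derive x v (fun z => \sum_(i < n) h i z) (\sum_(i < n) dh i).
Proof.
move=> H; have := is_derive_sum H.
rewrite (_ : \sum_(i < n) h i = (fun z => \sum_(i < n) h i z))//.
by apply/funext => z; rewrite fct_sumE.
Qed.

End derive_rules.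

Section functional.
Context {R : realType} {n : nat}.
Implicit Types f g h : 'rV[R]_n -> R.

Definition Rn_int f : R := fine (integral_Rn f).

Lemma Rn_intE f : Cc f -> integral_Rn f = (Rn_int f)%:E.
Proof. by move=> /Cc_integrable If; rewrite /Rn_int fineK//; exact: integrable_fin_num. Qed.

Lemma eq_Cc f g : f =1 g -> Cc f -> Cc g.
Proof. by move=> /funext ->. Qed.

Lemma CcD f g : Cc f -> Cc g -> Cc (fun x => f x + g x).
Proof.
move=> [cf [A fA]] [cg [B gB]]; split.
  by move=> x; exact: (continuousD (cf x) (cg x)).
by exists (Num.max A B) => x; rewrite gt_max => /andP[Ax Bx]; rewrite fA// gB// addr0.
Qed.

Lemma CcMl h f : continuous h -> Cc f -> Cc (fun x => h x * f x).
Proof.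
move=> ch [cf [A fA]]; split.
  by move=> x; exact: (continuousM (ch x) (cf x)).
by exists A => x /fA ->; rewrite mulr0.
Qed.

Lemma CcMr h f : continuous h -> Cc f -> Cc (fun x => f x * h x).
Proof.
by move=> ch /(CcMl ch); apply: eq_Cc => x; rewrite mulrC.
Qed.

Lemma CcZ c f : Cc f -> Cc (fun x => c * f x).
Proof. by apply: (@CcMl (fun=> c)) => x; exact: cst_continuous. Qed.

Lemma CcB f g : Cc f -> Cc g -> Cc (fun x => f x - g x).
Proof.
by move=> Cf /(CcZ (-1))/(CcD Cf); apply: eq_Cc => x; rewrite mulN1r.
Qed.

Lemma Cc_norm f : Cc f -> Cc (fun x => `|f x|).
Proof.
move=> [cf [A fA]]; split.
  by move=> x; apply: continuous_comp; [exact: cf|exact: norm_continuous].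
by exists A => x /fA ->; rewrite normr0.
Qed.

Lemma Cc0 : Cc (fun _ : 'rV[R]_n => 0).
Proof. by split; [move=> x; exact: cst_continuous|exists 0]. Qed.

Lemma Cc_sum m (F : 'I_m -> 'rV[R]_n -> R) : (forall i, Cc (F i)) ->
  Cc (fun x => \sum_(i < m) F i x).
Proof.
elim: m F => [|m IH] F CF.
  by under eq_fun do rewrite big_ord0; exact: Cc0.
by under eq_fun do rewrite big_ord_recr; apply: CcD => //; exact: IH.
Qed.

Lemma eq_Rn_int f g : f =1 g -> Rn_int f = Rn_int g.
Proof. by move=> fg; congr (fine (integral_Rn _)); apply/funext. Qed.

Lemma Rn_intD f g : Cc f -> Cc g -> Rn_int (fun x => f x + g x) = Rn_int f + Rn_int g.
Proof. by move=> /Cc_integrable If /Cc_integrable Ig; exact: RintegralD. Qed.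

Lemma Rn_intZ c f : Cc f -> Rn_int (fun x => c * f x) = c * Rn_int f.
Proof. by move=> /Cc_integrable If; exact: RintegralZl. Qed.

Lemma Rn_int0 : Rn_int (fun _ => 0) = 0.
Proof. by rewrite -[RHS](mul0r (Rn_int (fun=> 0))) -(Rn_intZ _ Cc0) mul0r. Qed.

Lemma Rn_intB f g : Cc f -> Cc g -> Rn_int (fun x => f x - g x) = Rn_int f - Rn_int g.
Proof.
move=> Cf Cg; rewrite -mulN1r -Rn_intZ// -Rn_intD//; last exact: CcZ.
by apply: eq_Rn_int => x; rewrite mulN1r.
Qed.

Lemma Rn_int_sum m (F : 'I_m -> 'rV[R]_n -> R) : (forall i, Cc (F i)) ->
  Rn_int (fun x => \sum_(i < m) F i x) = \sum_(i < m) Rn_int (F i).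
Proof.
elim: m F => [|m IH] F CF.
  by rewrite big_ord0 (eq_Rn_int (g := fun=> 0)) ?Rn_int0// => x; rewrite big_ord0.
rewrite [RHS]big_ord_recr /= -IH// -Rn_intD//; last exact: Cc_sum.
by apply: eq_Rn_int => x; rewrite big_ord_recr.
Qed.

Lemma le_Rn_int f g : Cc f -> Cc g -> (forall x, f x <= g x) -> Rn_int f <= Rn_int g.
Proof.
by move=> /Cc_integrable If /Cc_integrable Ig fg; apply: le_Rintegral => // t _; exact: fg.
Qed.

Lemma ler_norm_Rn_int f g : Cc f -> Cc g -> (forall x, `|f x| <= g x) ->
  `|Rn_int f| <= Rn_int g.
Proof.
move=> Cf Cg fg; rewrite ler_norml -mulN1r -Rn_intZ//; apply/andP; split.
  apply: le_Rn_int => //; first exact: CcZ.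
  by move=> x; have := fg x; rewrite ler_norml mulN1r => /andP[].
by apply: le_Rn_int => // x; exact: (le_trans (ler_norm _)).
Qed.

Lemma Rn_int_ge0 f : Cc f -> (forall x, 0 <= f x) -> 0 <= Rn_int f.
Proof. by move=> Cf f0; rewrite -Rn_int0; apply: le_Rn_int => //; exact: Cc0. Qed.

(** Continuity bounds f from below on a box, which has positive measure. *)
Lemma Rn_int_gt0 f p : Cc f -> (forall x, 0 <= f x) -> 0 < f p -> 0 < Rn_int f.
Proof.
move=> Cf f0 fp.
have [e e0 He] := continuous_dist (Cf.1 p) (divr_gt0 fp (ltr0Sn R 1)).
have mb := measurable_box p e; have /andP[b0 boo] := lebesgue_box p e0.
rewrite -lte_fin -Rn_intE//.
have fp2 : 0 < f p / 2 by rewrite divr_gt0.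
apply: (@lt_le_trans _ _ ((f p / 2)%:E * lebesgue_tuple n (box p e))%E).
  by rewrite mule_gt0.
pose b := box p e.
have mi : measurable_fun setT (fun t => (\1_b t)%:E : \bar R).
  by apply/measurable_EFinP; exact: measurable_indic.
have i0 (t : n.-tuple (measurableTypeR R)) : (0 <= (\1_b t : R)%:E)%E by rewrite lee_fin.
rewrite -[X in lebesgue_tuple n X]setIT -integral_indic// -(ge0_integralZl _ measurableT mi)//; last first.
  by rewrite lee_fin ltW.
apply: ge0_le_integral => //.
- by move=> x _; rewrite mule_ge0// lee_fin ltW.
- exact: measurable_funeM.
- by case/integrableP : (Cc_integrable Cf).
move=> t _; rewrite -EFinM lee_fin indicE.
have [|_] := boolP (t \in _); last by rewrite mulr0.
rewrite inE mulr1 => tb.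
have : `|f (vec_of t) - f p| < f p / 2.
  by apply: He; apply: norm_lt_coord => // i; rewrite !mxE; exact: tb.
by rewrite ltr_norml /vec_of; lra.
Qed.

Lemma Rn_int_partial i f g : Cc f -> Cc g ->
  (forall x, is_derive x (delta_mx 0 i) f (g x)) -> Rn_int g = 0.
Proof. by move=> Cf Cg /(integral_partial Cf Cg); rewrite /Rn_int => ->. Qed.

End functional.

Section flat.
Context {R : realType}.

(** A quadratic error term gives a derivative; this is how derivatives are found
at the points where a function is defined by cases, and for integrals that
depend on a parameter. *)
Lemma is_derive_quadratic (f : R -> R) (x df C : R) :
  (forall h, `|h| < 1 -> `|f (h + x) - f x - h * df| <= C * h ^+ 2) ->
  is_derive x (1 : R) f df.
Proof.
move=> H.
suff : (fun h : R => h^-1 *: (f (h *: (1 : R) + x) - f x)) @ (0 : R)^' --> df.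
  move=> L; split; first by apply/cvg_ex; exists df.
  by apply: cvg_lim.
apply/cvgrPdist_lt => e e0.
have C0 : 0 <= `|C| + 1 by rewrite addr_ge0.
near=> h.
have h0 : h != 0 by near: h; exact: nbhs_dnbhs_neq.
have h1 : `|h| < 1.
  by near: h; apply: dnbhs0_lt.
have he : `|h| < e / (`|C| + 1).
  by near: h; apply: dnbhs0_lt; rewrite divr_gt0// ltr_wpDl.
rewrite [h *: 1]mulr1 -[_ *: _]/(h^-1 * _).
have -> : df - h^-1 * (f (h + x) - f x) = - (h^-1 * (f (h + x) - f x - h * df)).
  by field.
rewrite normrN normrM normfV mulrC ltr_pdivrMr ?normr_gt0//.
apply: le_lt_trans (H h h1) _.
rewrite -real_normK ?num_real// expr2 mulrA ltr_pM2r ?normr_gt0//.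
move: he; rewrite ltr_pdivlMr ?ltr_wpDl// => he.
apply: le_lt_trans he; rewrite mulrC ler_wpM2l//.
by apply: le_trans (ler_norm _) _; rewrite lerDl.
Unshelve. all: by end_near. Qed.

Definition pos_pow q (r : R) : R := Num.max r 0 ^+ q.

Lemma pos_pow_ge0 q r : 0 <= pos_pow q r.
Proof. by rewrite exprn_ge0// le_max lexx orbT. Qed.

Lemma pos_pow_le0 q r : r <= 0 -> pos_pow q.+1 r = 0.
Proof. by move=> r0; rewrite /pos_pow max_r// expr0n. Qed.

Lemma pos_pow_ge q r : 0 <= r -> pos_pow q r = r ^+ q.
Proof. by move=> r0; rewrite /pos_pow max_l. Qed.

Lemma pos_powS q r : r * pos_pow q.+1 r = pos_pow q.+2 r.
Proof.
have [r0|r0] := leP 0 r; first by rewrite !pos_pow_ge// -exprS.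
by rewrite !pos_pow_le0 ?mulr0// ltW.
Qed.

Lemma continuous_pos_pow q : continuous (pos_pow q).
Proof.
move=> r; apply: (@continuous_comp _ _ _ (fun r : R => Num.max r 0)
  (fun r => r ^+ q)); last exact: exprn_continuous.
apply: (@continuous_max R R id (fun=> 0)); first exact: cvg_id.
exact: cst_continuous.
Qed.

Lemma is_derive_pos_pow q (r : R) :
  is_derive r (1 : R) (pos_pow q.+2) (q.+2%:R * pos_pow q.+1 r).
Proof.
have [r0|r0|r0] := ltgtP r 0.
- rewrite pos_pow_le0 ?ltW// mulr0.
  apply: (@near_eq_is_derive _ _ _ (fun=> 0)).
  near=> z; rewrite pos_pow_le0// ltW//; near: z; exact: lt_nbhsl.
- have D : is_derive r (1 : R) (fun z : R => z ^+ q.+2) (q.+2%:R * pos_pow q.+1 r).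
    rewrite pos_pow_ge ?ltW//.
    by apply: is_derive_eq (is_derive_pow q.+2 (is_derive_id r 1)) _; rewrite mulr1.
  apply: near_eq_is_derive D.
  near=> z; rewrite pos_pow_ge// ltW//; near: z; exact: lt_nbhsr.
- rewrite r0 pos_pow_le0// mulr0; apply: (@is_derive_quadratic _ _ _ 1) => h h1.
  rewrite addr0 mulr0 (pos_pow_le0 _ (lexx 0)) !subr0 mul1r ger0_norm ?pos_pow_ge0//.
  have [h0|h0] := leP 0 h; last by rewrite pos_pow_le0 ?sqr_ge0// ltW.
  rewrite pos_pow_ge//; apply: ler_wiXn2l => //.
  by move: h1; rewrite ger0_norm// => /ltW.
Unshelve. all: by end_near. Qed.

(** The functions r^(-q) exp (- eps / r), extended by 0 for r <= 0. The negative
powers are there because the derivative of the q-th one is a combination of the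
next two: smoothness follows by induction. *)
Definition flat (eps : R) q (r : R) : R :=
  if 0 < r then r^-1 ^+ q * expR (- (eps / r)) else 0.

Lemma flat_ge0 eps q r : 0 <= flat eps q r.
Proof.
rewrite /flat; case: ifP => // r0.
by rewrite mulr_ge0 ?expR_ge0// exprn_ge0// invr_ge0 ltW.
Qed.

Lemma flat0_le1 eps r : 0 <= eps -> flat eps 0 r <= 1.
Proof.
move=> e0; rewrite /flat; case: ifP => // r0.
by rewrite mul1r -expR0 ler_expR oppr_le0 divr_ge0// ltW.
Qed.

(** From exp z >= z^(q+2) / (q+2)! at z = eps / r. *)
Lemma flat_quadratic eps q r : 0 < eps ->
  flat eps q r <= (q.+2)`!%:R / eps ^+ q.+2 * r ^+ 2.
Proof.
move=> e0; rewrite /flat; case: ifPn => [r0|_]; last first.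
  by rewrite mulr_ge0 ?sqr_ge0// divr_ge0 ?exprn_ge0 ?ltW.
have := @expR_ge1Dxn R (eps / r) q.+1 (divr_ge0 (ltW e0) (ltW r0)).
set E := expR _; rewrite expRN -/E => HE.
have E0 : 0 < E by exact: expR_gt0.
have F0 : 0 < (q.+2)`!%:R :> R by rewrite ltr0n fact_gt0.
have : (eps / r) ^+ q.+2 / (q.+2)`!%:R <= E by lra.
rewrite ler_pdivrMr// => H2.
rewrite ler_pdivrMr//.
have e2 : 0 < eps ^+ q.+2 by rewrite exprn_gt0.
have -> : r^-1 ^+ q = r ^+ 2 * (eps / r) ^+ q.+2 / eps ^+ q.+2.
  rewrite exprMn -[in r^-1 ^+ q.+2]addn2 exprD.
  by field; rewrite !gt_eqF.
rewrite [leRHS](_ : _ = r ^+ 2 * (E * (q.+2)`!%:R) / eps ^+ q.+2); last by field; rewrite gt_eqF.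
by rewrite ler_pM2r ?invr_gt0// ler_pM2l ?exprn_gt0.
Qed.

Lemma is_derive_flat eps q r : 0 < eps ->
  is_derive r (1 : R) (flat eps q)
    (- q%:R * flat eps q.+1 r + eps * flat eps q.+2 r).
Proof.
move=> e0; have [r0|r0|r0] := ltgtP r 0.
- have fl q' : flat eps q' r = 0 by rewrite /flat ltNge (ltW r0).
  rewrite !fl !mulr0 addr0.
  apply: (@near_eq_is_derive _ _ _ (fun=> 0)).
  near=> z; rewrite /flat ltNge ltW//; near: z; exact: lt_nbhsl.
- have rn0 : r != 0 by rewrite gt_eqF.
  have dV : is_derive r (1 : R) (fun z : R => z^-1) (- r ^- 2).
    have := is_deriveV rn0 (is_derive_id r (1 : R)).
    by move=> H; apply: (is_derive_eq H); rewrite [_ *: _]mulr1.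
  have D := is_derive_mul (is_derive_pow q dV)
    (is_derive_chain (is_derive_mull (- eps) dV) (is_derive_expR _)).
  suff D' : is_derive r (1 : R) (fun z : R => z^-1 ^+ q * expR (- eps * z^-1))
      (- q%:R * flat eps q.+1 r + eps * flat eps q.+2 r).
    apply: near_eq_is_derive D'.
    near=> z; rewrite /flat mulNr ifT//; near: z; exact: lt_nbhsr.
  apply: (is_derive_eq D); rewrite /flat r0 -(mulNr eps); set E := expR _.
  case: q {D dV} => [|q] /=.
    by field.
  rewrite !exprS; set z := r^-1 ^+ q; field.
  exact: rn0.
- have fl q' : flat eps q' 0 = 0 by rewrite /flat ltxx.
  rewrite r0 !fl !mulr0 addr0.
  apply: (@is_derive_quadratic _ _ _ ((q.+2)`!%:R / eps ^+ q.+2)) => h _.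
  rewrite addr0 mulr0 fl !subr0 ger0_norm ?flat_ge0//.
  exact: flat_quadratic.
Unshelve. all: by end_near. Qed.

End flat.

(** * Functions of class C^k and functions of the distance *)

Section class_C_rules.
Context {R : realType} {n : nat}.
Implicit Types f g : 'rV[R]_n -> R.

Lemma class_C_continuous k f : class_C k f -> continuous f.
Proof. by case: k => [|k] //= []. Qed.

Lemma class_C_intro k f (df : 'I_n -> 'rV[R]_n -> R) : continuous f ->
  (forall i x, is_derive x (delta_mx 0 i) f (df i x)) ->
  (forall i, class_C k (df i)) -> class_C k.+1 f.
Proof.
move=> cf Hdf Cdf; split => // i; split=> [x|]; first by have [] := Hdf i x.
by rewrite (_ : partial i f = df i)//; apply/funext => x; have [] := Hdf i x.
Qed.

Lemma class_C_partial k f i : class_C k.+1 f -> class_C k (partial i f).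
Proof. by move=> [_ /(_ i)[]]. Qed.

Lemma class_C_is_derive k f i x : class_C k.+1 f ->
  is_derive x (delta_mx 0 i) f (partial i f x).
Proof. by move=> [_ /(_ i)[H _]]; exact: derivableP. Qed.

Lemma class_C_pred k f : class_C k.+1 f -> class_C k f.
Proof.
elim: k f => [|k IH] f Cf; first exact: class_C_continuous Cf.
apply: (class_C_intro (df := fun i => partial i f)).
- exact: class_C_continuous Cf.
- by move=> i x; exact: class_C_is_derive Cf.
- by move=> i; apply: IH; exact: class_C_partial.
Qed.

Lemma class_C_cst k (c : R) : class_C k (fun _ : 'rV[R]_n => c).
Proof.
elim: k c => [|k IH] c; first by move=> x; exact: cst_continuous.
apply: (class_C_intro (df := fun _ _ => 0)) => //.
by move=> x; exact: cst_continuous.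
Qed.

Lemma class_C_add k f g : class_C k f -> class_C k g ->
  class_C k (fun x => f x + g x).
Proof.
elim: k f g => [|k IH] f g Cf Cg.
  by move=> x; exact: (continuousD (Cf x) (Cg x)).
apply: (class_C_intro (df := fun i x => partial i f x + partial i g x)).
- move=> x; apply: (@continuousD _ _ _ f g); first exact: (class_C_continuous Cf).
  exact: (class_C_continuous Cg).
- by move=> i x; apply: is_derive_add; [exact: class_C_is_derive Cf|exact: class_C_is_derive Cg].
- by move=> i; apply: IH; exact: class_C_partial.
Qed.

Lemma class_C_mul k f g : class_C k f -> class_C k g ->
  class_C k (fun x => f x * g x).
Proof.
elim: k f g => [|k IH] f g Cf Cg.
  by move=> x; exact: (continuousM (Cf x) (Cg x)).
apply: (class_C_intro (df := fun i x => partial i f x * g x + f x * partial i g x)).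
- move=> x; apply: (@continuousM _ _ f g); first exact: (class_C_continuous Cf).
  exact: (class_C_continuous Cg).
- by move=> i x; apply: is_derive_mul; [exact: class_C_is_derive Cf|exact: class_C_is_derive Cg].
- move=> i; apply: class_C_add; apply: IH; by [exact: class_C_partial|exact: class_C_pred].
Qed.

Lemma class_C_pow k f j : class_C k f -> class_C k (fun x => f x ^+ j).
Proof.
move=> Cf; elim: j => [|j IH]; first exact: class_C_cst.
by under eq_fun do rewrite exprS; exact: class_C_mul.
Qed.

Lemma class_C_sum k m (F : 'I_m -> 'rV[R]_n -> R) : (forall i, class_C k (F i)) ->
  class_C k (fun x => \sum_(i < m) F i x).
Proof.
elim: m F => [|m IH] F CF.
  by under eq_fun do rewrite big_ord0; exact: class_C_cst.
by under eq_fun do rewrite big_ord_recr; apply: class_C_add => //; exact: IH.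
Qed.

Lemma is_derive_coord i j (x : 'rV[R]_n) :
  is_derive x (delta_mx 0 i) (fun z : 'rV[R]_n => z 0 j) (i == j)%:R.
Proof.
apply/is_derive_line.
under eq_fun do rewrite !mxE eqxx /= eq_sym.
have := is_derive_add (is_derive_mul (is_derive_id (0 : R) (1 : R))
  (is_derive_cst ((i == j)%:R : R) (0 : R) (1 : R))) (is_derive_cst (x 0 j : R) (0 : R) (1 : R)).
by move=> H; apply: (is_derive_eq H); rewrite mul1r mulr0 !addr0.
Qed.

Lemma class_C_coord k j : class_C k (fun x : 'rV[R]_n => x 0 j).
Proof.
case: k => [|k]; first by move=> x; exact: coord_continuous.
apply: (class_C_intro (df := fun i _ => (i == j)%:R)).
- by move=> x; exact: coord_continuous.
- by move=> i x; exact: is_derive_coord.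
- by move=> i; exact: class_C_cst.
Qed.

(** The induction is on the order of differentiability, for all q at once. *)
Lemma class_C_flat k eps q f : 0 < eps -> (forall j, class_C j f) ->
  class_C k (fun x => flat eps q (f x)).
Proof.
move=> e0 Cf.
have cF j : continuous (fun x => flat eps j (f x)).
  move=> x; apply: (@continuous_comp _ _ _ f (flat eps j)); first exact: (Cf 0%N).
  exact: is_derive_continuous1 (is_derive_flat j (f x) e0).
elim: k q => [|k IH] q; first exact: cF.
apply: (class_C_intro (df := fun i x =>
  (- q%:R * flat eps q.+1 (f x) + eps * flat eps q.+2 (f x)) * partial i f x)).
- exact: cF.
- move=> i x; apply: is_derive_chain; last exact: is_derive_flat.
  exact: class_C_is_derive (Cf 1%N).
- move=> i; apply: class_C_mul; last exact: class_C_partial.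
  by apply: class_C_add; apply: class_C_mul => //; exact: class_C_cst.
Qed.

End class_C_rules.

Section radial.
Context {R : realType} {n : nat}.
Implicit Types x y : 'rV[R]_n.

(** Positive exactly on the ball of center y and radius T^(1/2); truncated powers
of it vanish outside of this ball. *)
Definition rad (T : R) y x : R := T - \sum_i (x 0 i - y 0 i) ^+ 2.

Lemma is_derive_coordB i j (c : R) x :
  is_derive x (delta_mx 0 i) (fun z : 'rV[R]_n => z 0 j - c) (i == j)%:R.
Proof.
have H := is_derive_add (is_derive_coord i j x) (is_derive_cst (- c) x (delta_mx 0 i)).
by apply: (is_derive_eq H); rewrite addr0.
Qed.

Lemma is_derive_rad i T y x :
  is_derive x (delta_mx 0 i) (rad T y) (-2 * (x 0 i - y 0 i)).
Proof.
have H := is_derive_add (is_derive_cst T x (delta_mx 0 i)) (is_derive_mull (-1)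
  (is_derive_bigsum (fun j => is_derive_pow 2 (is_derive_coordB i j (y 0 j) x)))).
have -> : rad T y = (fun z => T + -1 * \sum_j (z 0 j - y 0 j) ^+ 2).
  by apply/funext => z; rewrite /rad mulN1r.
apply: (is_derive_eq H); rewrite add0r (bigD1 i)//= eqxx big1 => [|j ji].
  by rewrite /= addr0 expr1 mulr1; ring.
by rewrite eq_sym (negbTE ji) mulr0.
Qed.

Lemma class_C_coordB k j (c : R) : class_C k (fun x => x 0 j - c).
Proof. by apply: class_C_add; [exact: class_C_coord|exact: class_C_cst]. Qed.

Lemma class_C_rad k T y : class_C k (rad T y).
Proof.
have -> : rad T y = (fun z => T + -1 * \sum_j (z 0 j - y 0 j) ^+ 2).
  by apply/funext => z; rewrite /rad mulN1r.
apply: class_C_add; first exact: class_C_cst.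
apply: class_C_mul; first exact: class_C_cst.
by apply: class_C_sum => j; apply: class_C_pow; exact: class_C_coordB.
Qed.

Lemma continuous_rad T y : continuous (rad T y).
Proof. exact: (class_C_rad 0 T y). Qed.

Lemma sqdist_ge0 y x : 0 <= \sum_i (x 0 i - y 0 i) ^+ 2.
Proof. by apply: sumr_ge0 => i _; exact: sqr_ge0. Qed.

Lemma rad_le T y x : rad T y x <= T.
Proof. by have := sqdist_ge0 y x; rewrite /rad; lra. Qed.

Lemma rad_coord T y x i : 0 <= rad T y x -> (x 0 i - y 0 i) ^+ 2 <= T.
Proof.
rewrite /rad (bigD1 i)//= => H.
have : 0 <= \sum_(j | j != i) (x 0 j - y 0 j) ^+ 2.
  by apply: sumr_ge0 => j _; exact: sqr_ge0.
by move: H; lra.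
Qed.

Lemma rad_bounded T y : exists B, forall x, 0 <= rad T y x -> `|x| <= B.
Proof.
exists (`|y| + (T ^+ 2 + 1)) => x r0.
apply: norm_le_coord => [|i]; first by rewrite !addr_ge0// sqr_ge0.
have := rad_coord i r0; have := coord_le_norm y i.
set yi := y 0 i; set xi := x 0 i => Hy Hx.
have : `|xi - yi| <= T ^+ 2 + 1.
  have zE := real_normK (num_real (xi - yi)); move: zE Hx.
  move: (`|xi - yi|) => z <- zT.
  have am t : 2 * t <= t ^+ 2 + 1 :> R.
    by rewrite -subr_ge0 (_ : _ - _ = (t - 1) ^+ 2) ?sqr_ge0//; ring.
  by have := am z; have := am T; have := sqr_ge0 T; lra.
have := ler_normD (xi - yi) yi; rewrite subrK; lra.
Qed.

Lemma Cc_rad (F : R -> R) T y : continuous F -> (forall r, r <= 0 -> F r = 0) ->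
  Cc (fun x => F (rad T y x)).
Proof.
move=> cF F0; split.
  by move=> x; apply: continuous_comp; [exact: continuous_rad|exact: cF].
have [B HB] := rad_bounded T y; exists B => x Bx; apply: F0.
rewrite leNgt; apply/negP => /ltW/HB xB.
by move: (lt_le_trans Bx xB); rewrite ltxx.
Qed.

Lemma Cc_pos_pow q T y : Cc (fun x => pos_pow q.+1 (rad T y x)).
Proof.
by apply: (Cc_rad (F := pos_pow q.+1)); [exact: continuous_pos_pow|move=> r; exact: pos_pow_le0].
Qed.

End radial.

(** * Cylindrical test functions *)

Section flat_radial.
Context {R : realType}.

(** Smooth approximation of the truncated power of exponent p. *)
Definition flat_pow eps p (r : R) : R := r ^+ p * flat eps 0 r.

Definition dflat_pow eps p (r : R) : R :=
  p.+2%:R * flat_pow eps p.+1 r + eps * flat_pow eps p r.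

Lemma is_derive_flat_pow eps p r : 0 < eps ->
  is_derive r (1 : R) (flat_pow eps p.+2) (dflat_pow eps p r).
Proof.
move=> e0; have H := is_derive_mul (is_derive_pow p.+2 (is_derive_id r (1 : R)))
  (is_derive_flat 0 r e0).
apply: (is_derive_eq H); rewrite /dflat_pow /flat_pow /=.
have -> : flat eps 0 r = r ^+ 2 * flat eps 2 r.
  rewrite /flat; case: ifP => [r0|]; last by rewrite mulr0.
  by rewrite expr0; field; rewrite gt_eqF.
rewrite !exprS; set z := r ^+ p; set f1 := flat _ 1 _; set f2 := flat _ 2 _.
rewrite mulr0n; ring.
Qed.

Lemma flat_pow_le0 eps p r : r <= 0 -> flat_pow eps p r = 0.
Proof. by move=> r0; rewrite /flat_pow /flat ltNge r0 mulr0. Qed.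

Lemma continuous_flat_pow eps p : 0 < eps -> continuous (flat_pow eps p).
Proof.
move=> e0 r; apply: is_derive_continuous1.
exact: is_derive_mul (is_derive_pow p (is_derive_id r (1 : R))) (is_derive_flat 0 r e0).
Qed.

Lemma continuous_dflat_pow eps p : 0 < eps -> continuous (dflat_pow eps p).
Proof.
move=> e0 r; apply: (@continuousD _ _ _ (fun r => p.+2%:R * flat_pow eps p.+1 r)).
  by apply: continuousM; [exact: cst_continuous|exact: continuous_flat_pow].
by apply: continuousM; [exact: cst_continuous|exact: continuous_flat_pow].
Qed.

(** From 1 - exp (- eps / r) <= eps / r: one power of r is traded for a factor
eps, whence an error that is uniform on bounded sets. *)
Lemma flat_pow_approx eps p r : 0 <= eps ->
  `|flat_pow eps p.+1 r - pos_pow p.+1 r| <= eps * pos_pow p r.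
Proof.
move=> e0; have [r0|r0] := leP r 0.
  by rewrite flat_pow_le0// pos_pow_le0// subrr normr0 mulr_ge0// pos_pow_ge0.
rewrite !(pos_pow_ge _ (ltW r0)) /flat_pow /flat r0 mul1r.
have -> : r ^+ p.+1 * expR (- (eps / r)) - r ^+ p.+1 =
   - (r ^+ p.+1 * (1 - expR (- (eps / r)))) by ring.
have e1 : expR (- (eps / r)) <= 1.
  by rewrite -expR0 ler_expR oppr_le0 divr_ge0// ltW.
rewrite normrN ger0_norm; last by rewrite mulr_ge0 ?subr_ge0// exprn_ge0// ltW.
have -> : eps * r ^+ p = r ^+ p.+1 * (eps / r).
  by rewrite exprS; field; rewrite gt_eqF.
rewrite ler_pM2l ?exprn_gt0//.
by have := expR_ge1Dx (- (eps / r)); lra.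
Qed.

Lemma flat_pow_norm eps p r : 0 <= eps -> `|flat_pow eps p r| <= pos_pow p r.
Proof.
move=> e0; have [r0|r0] := leP r 0.
  by rewrite flat_pow_le0// normr0 pos_pow_ge0.
rewrite (pos_pow_ge _ (ltW r0)) /flat_pow normrM ger0_norm; last by rewrite exprn_ge0// ltW.
rewrite -[leRHS]mulr1 ler_pM2l ?exprn_gt0// ger0_norm ?flat_ge0//.
exact: flat0_le1.
Qed.

Lemma dflat_pow_approx eps p r : 0 <= eps ->
  `|dflat_pow eps p.+1 r - p.+3%:R * pos_pow p.+2 r| <= eps * (p.+4%:R * pos_pow p.+1 r).
Proof.
move=> e0; rewrite /dflat_pow.
have -> : p.+3%:R * flat_pow eps p.+2 r + eps * flat_pow eps p.+1 r - p.+3%:R * pos_pow p.+2 r =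
   p.+3%:R * (flat_pow eps p.+2 r - pos_pow p.+2 r) + eps * flat_pow eps p.+1 r by ring.
apply: le_trans (ler_normD _ _) _.
have -> : eps * (p.+4%:R * pos_pow p.+1 r) =
    p.+3%:R * (eps * pos_pow p.+1 r) + eps * pos_pow p.+1 r.
  by rewrite -[p.+4%:R]natr1; ring.
apply: lerD; rewrite normrM ger0_norm//.
  exact: ler_wpM2l (flat_pow_approx _ _ e0).
exact: ler_wpM2l (flat_pow_norm _ _ e0).
Qed.

Lemma dflat_pow_norm eps p r : 0 <= eps -> eps <= 1 ->
  `|dflat_pow eps p r| <= p.+2%:R * pos_pow p.+1 r + pos_pow p r.
Proof.
move=> e0 e1; rewrite /dflat_pow.
apply: le_trans (ler_normD _ _) _.
apply: lerD; rewrite normrM ger0_norm//.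
  exact: ler_wpM2l (flat_pow_norm _ _ e0).
rewrite -[leRHS]mul1r; apply: ler_pM => //; exact: flat_pow_norm.
Qed.

End flat_radial.

Section cylindrical.
Context {R : realType} {m : nat}.
Notation E := 'rV[R]_m.+1.
Implicit Types x y : E.

Definition height y x : R := x 0 ord_max - y 0 ord_max.

(** The gradient of tau^(2k) F(rad) is cyl_r * F'(rad) + cyl_h * F(rad), where
tau is the height: cyl_r comes from the distance to y. *)
Definition cyl_r k y i x : R := (height y x ^+ 2) ^+ k * (-2 * (x 0 i - y 0 i)).

(** The part of the gradient of tau^(2k) F(rad) that comes from tau^(2k). *)
Definition cyl_h k y (i : 'I_m.+1) x : R :=
  if i == ord_max then 2 * k%:R * height y x * (height y x ^+ 2) ^+ k.-1 else 0.

Lemma is_derive_height2 k y i x :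
  is_derive x (delta_mx 0 i) (fun z : E => (height y z ^+ 2) ^+ k) (cyl_h k y i x).
Proof.
have H := is_derive_pow k (is_derive_pow 2 (is_derive_coordB i ord_max (y 0 ord_max) x)).
apply: (is_derive_eq H); rewrite /cyl_h -/(height y x); case: eqP => _ /=.
  by rewrite expr1 mulr1; ring.
by rewrite !mulr0.
Qed.

Lemma is_derive_cyl (F dF : R -> R) k T y i x :
  (forall r, is_derive r (1 : R) F (dF r)) ->
  is_derive x (delta_mx 0 i) (fun z : E => (height y z ^+ 2) ^+ k * F (rad T y z))
    (cyl_r k y i x * dF (rad T y x) + cyl_h k y i x * F (rad T y x)).
Proof.
move=> HF; have H := is_derive_mul (is_derive_height2 k y i x)
  (is_derive_chain (is_derive_rad i T y x) (HF _)).
by apply: (is_derive_eq H); rewrite /cyl_r; ring.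
Qed.

Lemma continuous_height y : continuous (height y).
Proof. exact: (class_C_coordB 0 ord_max (y 0 ord_max)). Qed.

Lemma class_C_height2 j k y : class_C j (fun x => (height y x ^+ 2) ^+ k).
Proof. by do 2 apply: class_C_pow; exact: class_C_coordB. Qed.

Lemma continuous_cyl_r k y i : continuous (cyl_r k y i).
Proof.
apply: (@class_C_mul _ _ 0 (fun x => (height y x ^+ 2) ^+ k)); first exact: class_C_height2.
by apply: (@class_C_mul _ _ 0 (fun=> -2)); [exact: class_C_cst|exact: class_C_coordB].
Qed.

Lemma continuous_cyl_h k y i : continuous (cyl_h k y i).
Proof.
rewrite /cyl_h; case: eqP => _; last exact: (class_C_cst 0).
apply: (@class_C_mul _ _ 0 (fun x => 2 * k%:R * height y x)); last exact: class_C_height2.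
by apply: (@class_C_mul _ _ 0 (fun=> 2 * k%:R)); [exact: class_C_cst|exact: class_C_coordB].
Qed.

Lemma Cc_cyl k T y i (U : E -> R) (F dF : R -> R) :
  continuous U -> continuous F -> continuous dF ->
  (forall r, r <= 0 -> F r = 0) -> (forall r, r <= 0 -> dF r = 0) ->
  Cc (fun x => U x * (cyl_r k y i x * dF (rad T y x) + cyl_h k y i x * F (rad T y x))).
Proof.
move=> cU cF cdF F0 dF0; apply: CcMl => //; apply: CcD.
  by apply: CcMl; [exact: continuous_cyl_r|exact: Cc_rad].
by apply: CcMl; [exact: continuous_cyl_h|exact: Cc_rad].
Qed.

Lemma continuous_last (F : R -> R) : continuous F ->
  continuous (fun x : E => F (x 0 ord_max)).
Proof.
by move=> cF x; apply: (@continuous_comp _ _ _ (fun x : E => x 0 ord_max) F);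
  [exact: coord_continuous|exact: cF].
Qed.

(** The weight om is a limit of w * G for smooth G whose derivative is harmless:
on bounded sets |w * dG| is small compared with 1 + s * dG, and the integral of
dG against a test function stays bounded, as one sees by integrating by
parts. *)
Definition cutoff_limit (w om : R -> R) : Prop := forall B kap, 0 < kap ->
  exists (G dG : R -> R) (s : R),
  [/\ forall j, class_C j (fun x : E => G (x 0 ord_max)),
      forall t, is_derive t (1 : R) G (dG t),
      continuous dG, forall t, `|G t| <= 1 & `|s| <= 1] /\
  forall t, `|t| <= B ->
    `|w t * G t - om t| <= kap /\ `|w t * dG t| <= kap * (1 + s * dG t).

(** The identity \int om <U, grad (tau^(2k) r_+^p)> = 0 for all k, T and p > 2,
where U is to be the gradient of the solution. *)
Definition weak_identity (om : R -> R) (U : 'I_m.+1 -> E -> R) y : Prop :=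
  forall k q T, Rn_int (fun x => \sum_i om (x 0 ord_max) * U i x *
    (cyl_r k y i x * (q.+3%:R * pos_pow q.+2 (rad T y x)) +
     cyl_h k y i x * pos_pow q.+3 (rad T y x))) = 0.

(** For the norm of R^n, closed and bounded sets are compact. *)
Lemma test_function_intro (phi : E -> R) : (forall j, class_C j phi) ->
  (exists B, forall x, B < `|x| -> phi x = 0) -> test_function phi.
Proof.
move=> Cphi [B HB]; split => //; apply: bounded_closed_compact; last exact: closed_closure.
exists B; split; first exact: num_real.
move=> M BM x.
have cl : closed [set x : E | `|x| <= M].
  apply: (@closed_comp _ _ (fun x : E => `|x|) [set t | t <= M]).
    by move=> z _; exact: norm_continuous.
  exact: closed_le.
move=> Hx; apply: cl; move: x Hx; apply: closure_subset => x /=.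
move=> /eqP phix; rewrite leNgt; apply/negP => Mx; apply: phix; apply: HB.
exact: lt_trans BM Mx.
Qed.

End cylindrical.

(** * From test functions to truncated powers *)

Section weak_limit.
Context {R : realType} {m : nat}.
Notation E := 'rV[R]_m.+1.
Implicit Types x y : E.

Lemma ler_norm_lin2 (p q s t S : R) : 0 <= S -> `|s| + `|t| <= S ->
  `|p * s + q * t| <= (`|p| + `|q|) * S.
Proof.
move=> S0 H; apply: le_trans (ler_normD _ _) _; rewrite !normrM mulrDl.
have s0 := normr_ge0 s; have t0 := normr_ge0 t.
by apply: lerD; apply: ler_wpM2l => //; lra.
Qed.

(** G is bounded but dG is not, as G approaches a step function: integrating by
parts moves the derivative away from G. *)
Lemma Rn_int_cutoff (G dG : R -> R) T y :
  (forall t, is_derive t (1 : R) G (dG t)) -> continuous dG -> (forall t, `|G t| <= 1) ->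
  `|Rn_int (fun x : E => dG (x 0 ord_max) * pos_pow 2 (rad T y x))| <=
  Rn_int (fun x : E => `|2 * pos_pow 1 (rad T y x) * (-2 * height y x)|).
Proof.
move=> HG cdG G1.
have cG : continuous G by move=> t; exact: is_derive_continuous1 (HG t).
have C2 : Cc (fun x : E => pos_pow 2 (rad T y x)) by exact: Cc_pos_pow.
have C1 : Cc (fun x : E => 2 * pos_pow 1 (rad T y x) * (-2 * height y x)).
  apply: CcMr; last by apply: CcZ; exact: Cc_pos_pow.
  by apply: (@class_C_mul _ _ 0 (fun=> -2)); [exact: class_C_cst|exact: continuous_height].
have Ca : Cc (fun x : E => dG (x 0 ord_max) * pos_pow 2 (rad T y x)).
  by apply: CcMl => //; exact: continuous_last.
have Cb : Cc (fun x : E => G (x 0 ord_max) * (2 * pos_pow 1 (rad T y x) * (-2 * height y x))).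
  by apply: CcMl => //; exact: continuous_last.
have : Rn_int (fun x : E => dG (x 0 ord_max) * pos_pow 2 (rad T y x) +
    G (x 0 ord_max) * (2 * pos_pow 1 (rad T y x) * (-2 * height y x))) = 0.
  apply: (@Rn_int_partial _ _ ord_max (fun x : E => G (x 0 ord_max) * pos_pow 2 (rad T y x))).
  - by apply: CcMl => //; exact: continuous_last.
  - exact: CcD.
  - move=> x.
    have H := is_derive_mul (is_derive_chain (is_derive_coord ord_max ord_max x) (HG _))
      (is_derive_chain (is_derive_rad ord_max T y x) (is_derive_pos_pow 0 _)).
    by apply: (is_derive_eq H); rewrite eqxx mulr1.
rewrite Rn_intD// => /eqP; rewrite addr_eq0 => /eqP ->; rewrite normrN.
apply: ler_norm_Rn_int => //; first exact: Cc_norm.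
by move=> x; rewrite normrM -[leRHS]mul1r ler_wpM2r.
Qed.

(** The test functions are G(x_n) tau^(2k) r^p exp (- kap / r). The difference
between w U . grad of such a function and its limit is at most
kap * S + kap * (1 + s * dG(x_n)) * C1 * r_+^2 with S and C1 independent of kap;
the last term is integrated with Rn_int_cutoff. So the limit integral is O(kap)
for every kap. *)
Lemma weak_limit (w om : R -> R) (U : 'I_m.+1 -> E -> R) y :
  continuous w -> continuous om -> (forall i, continuous (U i)) ->
  @cutoff_limit R m w om ->
  (forall phi, test_function phi ->
    Rn_int (fun x => \sum_i w (x 0 ord_max) * U i x * partial i phi x) = 0) ->
  weak_identity om U y.
Proof.
move=> cw com cU Hw HU k q T.
pose P j (x : E) := pos_pow j (rad T y x).
have P0 j x : 0 <= P j x by exact: pos_pow_ge0.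
have CP j : Cc (P j.+1) by exact: Cc_pos_pow.
pose N i x := `|cyl_r k y i x| + `|cyl_h k y i x|.
have N0 i x : 0 <= N i x by rewrite addr_ge0.
have cN i : continuous (N i).
  move=> x; apply: (@continuousD _ _ _ (fun x => `|cyl_r k y i x|)).
    by apply: continuous_comp; [exact: continuous_cyl_r|exact: norm_continuous].
  by apply: continuous_comp; [exact: continuous_cyl_h|exact: norm_continuous].
pose Psi x := q.+3%:R * P q.+2 x + P q.+1 x + P q.+3 x.
pose Psi' x := q.+4%:R * P q.+1 x + P q.+2 x.
have Psi0 x : 0 <= Psi x.
  by rewrite /Psi; have := P0 q.+1 x; have := P0 q.+3 x;
     have := mulr_ge0 (ler0n R q.+3) (P0 q.+2 x); lra.
have Psi'0 x : 0 <= Psi' x.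
  by rewrite /Psi'; have := P0 q.+2 x; have := mulr_ge0 (ler0n R q.+4) (P0 q.+1 x); lra.
have CPsi : Cc Psi by apply: CcD => //; apply: CcD => //; exact: CcZ.
have CPsi' : Cc Psi' by apply: CcD => //; exact: CcZ.
pose S x := \sum_i `|U i x| * (N i x * Psi x + `|om (x 0 ord_max)| * (N i x * Psi' x)).
have cnorm (f : E -> R) : continuous f -> continuous (fun x => `|f x|).
  by move=> cf x; apply: continuous_comp; [exact: cf|exact: norm_continuous].
have CS : Cc S.
  apply: Cc_sum => i; apply: CcMl; first exact: cnorm.
  apply: CcD; first exact: CcMl.
  apply: CcMl; last exact: CcMl.
  by apply: cnorm; exact: continuous_last.
(* C1 absorbs all the factors of the term with dG, except for r_+^2. *)
have [_ [C1 [_ C10 HC1 _]]] : exists B C, [/\ 0 < B, 0 < C,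
    forall x, `|U ord_max x * (height y x ^+ 2) ^+ k * P q.+1 x| <= C &
    forall x, B <= `|x| -> U ord_max x * (height y x ^+ 2) ^+ k * P q.+1 x = 0].
  apply: Cc_bounded; apply: CcMl => // x.
  apply: (@continuousM _ _ (U ord_max) (fun x => (height y x ^+ 2) ^+ k)); first exact: cU.
  exact: (class_C_height2 0).
pose Q := Rn_int (fun x : E => `|2 * pos_pow 1 (rad T y x) * (-2 * height y x)|).
pose A0 i x := cyl_r k y i x * (q.+3%:R * P q.+2 x) + cyl_h k y i x * P q.+3 x.
pose f0 x := \sum_i om (x 0 ord_max) * U i x * A0 i x.
rewrite -/(f0).
have cpp j : continuous (pos_pow (R := R) j) by exact: continuous_pos_pow.
have Cf0 : Cc f0.
  apply: Cc_sum => i; apply: (@Cc_cyl _ _ k T y i (fun x => om (x 0 ord_max) * U i x)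
    (pos_pow q.+3) (fun r => q.+3%:R * pos_pow q.+2 r)).
  - move=> x; apply: (@continuousM _ _ (fun x : E => om (x 0 ord_max))); last exact: cU.
    exact: continuous_last.
  - exact: cpp.
  - move=> r; apply: (@continuousM _ _ (fun=> q.+3%:R) (pos_pow q.+2)); last exact: cpp.
    exact: cst_continuous.
  - by move=> r r0; rewrite pos_pow_le0.
  - by move=> r r0; rewrite pos_pow_le0// mulr0.
suff key kap : 0 < kap -> kap <= 1 -> `|Rn_int f0| <= kap * (Rn_int S + C1 * (Rn_int (P 2) + Q)).
  have K0 : 0 <= Rn_int S + C1 * (Rn_int (P 2) + Q).
    by have := key 1 ltr01 (lexx _); rewrite mul1r; exact: le_trans.
  apply/eqP; rewrite -normr_le0 leNgt; apply/negP => L0.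
  (* The value kap = L / (L + K + 1), with L the integral, contradicts
     L <= kap * K. *)
  set K := Rn_int S + _ in key K0.
  have K1 : 0 < `|Rn_int f0| + K + 1 by lra.
  have k0 : 0 < `|Rn_int f0| / (`|Rn_int f0| + K + 1) by rewrite divr_gt0.
  have k1 : `|Rn_int f0| / (`|Rn_int f0| + K + 1) <= 1 by rewrite ler_pdivrMr//; lra.
  by have := key _ k0 k1; rewrite mulrAC ler_pdivlMr// ler_pM2l//; lra.
move=> k0 k1.
have [B HB] := rad_bounded T y.
have [G [dG [s [[sG HG cdG G1 s1] Hlim]]]] := Hw B kap k0.
have cG : continuous G by move=> t; exact: is_derive_continuous1 (HG t).
pose rho x := flat_pow kap q.+3 (rad T y x).
pose drho x := dflat_pow kap q.+1 (rad T y x).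
pose phi x := G (x 0 ord_max) * ((height y x ^+ 2) ^+ k * rho x).
pose A i x := cyl_r k y i x * drho x + cyl_h k y i x * rho x.
have tphi : test_function phi.
  apply: test_function_intro => [j|].
    apply: class_C_mul; first exact: sG.
    apply: class_C_mul; first exact: class_C_height2.
    apply: class_C_mul; first by apply: class_C_pow; exact: class_C_rad.
    by apply: class_C_flat => // i; exact: class_C_rad.
  exists B => x Bx; rewrite /phi /rho flat_pow_le0 ?mulr0//.
  rewrite leNgt; apply/negP => /ltW/HB xB.
  by move: (lt_le_trans Bx xB); rewrite ltxx.
have dphi i x : partial i phi x = G (x 0 ord_max) * A i x +
    (i == ord_max)%:R * (dG (x 0 ord_max) * ((height y x ^+ 2) ^+ k * rho x)).
  have H := is_derive_mul (is_derive_chain (is_derive_coord i ord_max x) (HG _))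
    (is_derive_cyl k T y i x (fun r => is_derive_flat_pow q.+1 r k0)).
  by have [_] := H; rewrite /partial /A /phi /rho /drho => ->; ring.
(* The pairing with a genuine test function, which tends to f0 with kap. *)
pose f1 x := \sum_i w (x 0 ord_max) * U i x * partial i phi x.
have f1E x : f1 x = \sum_i w (x 0 ord_max) * G (x 0 ord_max) * (U i x * A i x) +
    w (x 0 ord_max) * dG (x 0 ord_max) * (U ord_max x * (height y x ^+ 2) ^+ k * rho x).
  rewrite /f1; under eq_bigr do rewrite dphi mulrDr.
  rewrite big_split /=; congr (_ + _).
    by apply: eq_bigr => i _; ring.
  rewrite (bigD1 ord_max)//= eqxx big1 => [|i /negbTE ->]; last by rewrite mul0r mulr0.
  by rewrite addr0 mul1r; ring.
have Cf1 : Cc f1.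
  apply: (eq_Cc (fun x => esym (f1E x))); apply: CcD.
    apply: Cc_sum => i; apply: CcMl.
      by apply: (@continuous_last _ _ (fun t => w t * G t)) => t; exact: (continuousM (cw t) (cG t)).
    apply: (@Cc_cyl _ _ k T y i (U i) (flat_pow kap q.+3) (dflat_pow kap q.+1)) => //.
    - exact: continuous_flat_pow.
    - exact: continuous_dflat_pow.
    - by move=> r r0; rewrite flat_pow_le0.
    - by move=> r r0; rewrite /dflat_pow !flat_pow_le0// !mulr0 addr0.
  apply: CcMl.
    by apply: (@continuous_last _ _ (fun t => w t * dG t)) => t; exact: (continuousM (cw t) (cdG t)).
  apply: CcMl.
    move=> x; apply: (@continuousM _ _ (U ord_max) (fun x => (height y x ^+ 2) ^+ k)); first exact: cU.
    exact: (class_C_height2 0).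
  apply: (Cc_rad (F := flat_pow kap q.+3)); first exact: continuous_flat_pow.
  by move=> r r0; rewrite flat_pow_le0.
have CP2 : Cc (P 2) by exact: CP.
have CdP : Cc (fun x : E => dG (x 0 ord_max) * P 2 x).
  by apply: CcMl => //; exact: continuous_last.
have -> : Rn_int f0 = - (Rn_int f1 - Rn_int f0) by rewrite HU// sub0r opprK.
rewrite normrN -Rn_intB//.
apply: (@le_trans _ _ (Rn_int (fun x => kap * (S x + C1 * (P 2 x + s * (dG (x 0 ord_max) * P 2 x)))))).
  apply: ler_norm_Rn_int; first exact: CcB.
    by apply: CcZ; apply: CcD => //; apply: CcZ; apply: CcD => //; exact: CcZ.
  move=> x; have [r0|r0] := leP (rad T y x) 0.
    have z (j : nat) : P j.+1 x = 0 by exact: pos_pow_le0.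
    have rho0 : rho x = 0 by exact: flat_pow_le0.
    have drho0 : drho x = 0 by rewrite /drho /dflat_pow !flat_pow_le0// !mulr0 addr0.
    rewrite f1E /f0 /S !big1 => [|i _|i _|i _]; rewrite ?z.
    - by rewrite rho0 !mulr0 !addr0 subrr normr0 !mulr0 addr0 mulr0.
    - by rewrite /Psi /Psi' !z !(mulr0,addr0).
    - by rewrite /A0 !z !(mulr0,addr0).
    - by rewrite /A rho0 drho0 !(mulr0,addr0).
  have xB : `|x 0 ord_max| <= B by apply: le_trans (coord_le_norm _ _) (HB x (ltW r0)).
  have [wG wdG] := Hlim _ xB.
  set wx := w _ in wG wdG *; set Gx := G _ in wG *; set dGx := dG _ in wdG *.
  set ox := om (x 0 ord_max) in wG *.
  have -> : f1 x - f0 x = (\sum_i U i x * ((wx * Gx - ox) * A i x + ox * (A i x - A0 i x))) +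
     wx * dGx * (U ord_max x * (height y x ^+ 2) ^+ k * rho x).
    rewrite f1E /f0 addrAC -sumrB; congr (_ + _); apply: eq_bigr => i _.
    by rewrite -/wx -/Gx -/ox; ring.
  have rn : `|rho x| <= P q.+3 x by apply: flat_pow_norm; exact: ltW.
  have drn : `|drho x| <= q.+3%:R * P q.+2 x + P q.+1 x by apply: dflat_pow_norm => //; exact: ltW.
  have ra : `|rho x - P q.+3 x| <= kap * P q.+2 x by apply: flat_pow_approx; exact: ltW.
  have dra : `|drho x - q.+3%:R * P q.+2 x| <= kap * (q.+4%:R * P q.+1 x).
    by apply: dflat_pow_approx; exact: ltW.
  have An i : `|A i x| <= N i x * Psi x.
    by apply: ler_norm_lin2 => //; rewrite /Psi; lra.
  have Aa i : `|A i x - A0 i x| <= kap * (N i x * Psi' x).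
    have -> : A i x - A0 i x = cyl_r k y i x * (drho x - q.+3%:R * P q.+2 x) +
        cyl_h k y i x * (rho x - P q.+3 x) by rewrite /A /A0; ring.
    rewrite [leRHS]mulrCA; apply: ler_norm_lin2; first by rewrite mulr_ge0// ltW.
    by rewrite /Psi' mulrDr; lra.
  rewrite mulrDr; apply: le_trans (ler_normD _ _) _; apply: lerD.
    rewrite /S mulr_sumr; apply: le_trans (ler_norm_sum _ _ _) _; apply: ler_sum => i _.
    rewrite normrM [leRHS]mulrCA; apply: ler_wpM2l => //.
    apply: le_trans (ler_normD _ _) _; rewrite !normrM mulrDr; apply: lerD.
      by apply: ler_pM.
    by rewrite [leRHS]mulrCA; apply: ler_wpM2l.
  rewrite normrM.
  have -> : kap * (C1 * (P 2 x + s * (dGx * P 2 x))) = kap * (1 + s * dGx) * (C1 * P 2 x) by ring.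
  apply: ler_pM => //.
  rewrite normrM; apply: (@le_trans _ _ (`|U ord_max x * (height y x ^+ 2) ^+ k| * P q.+3 x)).
    exact: ler_wpM2l.
  have -> : P q.+3 x = P q.+1 x * P 2 x by rewrite /P /pos_pow -exprD addn2.
  rewrite mulrA; apply: ler_wpM2r => //.
  by apply: le_trans (HC1 x); rewrite [leRHS]normrM (ger0_norm (P0 _ _)).
rewrite Rn_intZ; last by apply: CcD => //; apply: CcZ; apply: CcD => //; exact: CcZ.
apply: ler_wpM2l; first exact: ltW.
rewrite Rn_intD//; last by apply: CcZ; apply: CcD => //; exact: CcZ.
rewrite lerD2l Rn_intZ; last by apply: CcD => //; exact: CcZ.
apply: ler_wpM2l; first exact: ltW.
rewrite Rn_intD//; last exact: CcZ.
rewrite lerD2l Rn_intZ//; apply: le_trans (ler_norm _) _; rewrite normrM.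
rewrite -[leRHS]mul1r; apply: ler_pM => //.
exact: Rn_int_cutoff.
Qed.

End weak_limit.

(** * The relation between moments *)

Section moment_relation.
Context {R : realType} {m : nat}.
Notation E := 'rV[R]_m.+1.
Implicit Types x y : E.

(** The moments J_(k,q) (T) of v for the weight om, over balls of center y. *)
Definition moment (om : R -> R) (v : E -> R) y k q T : R :=
  Rn_int (fun x => v x * (om (x 0 ord_max) *
    ((height y x ^+ 2) ^+ k * pos_pow q (rad T y x)))).

(** The weight om may fail to be differentiable, but along the other coordinates
it is constant. *)
Lemma is_derive_last_transverse (om : R -> R) (i : 'I_m.+1) x : i != ord_max ->
  is_derive x (delta_mx 0 i) (fun z : E => om (z 0 ord_max)) 0.
Proof.
move=> iN; apply/is_derive_line.
under eq_fun do rewrite !mxE eqxx /= eq_sym (negbTE iN) mulr0 add0r.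
exact: is_derive_cst.
Qed.

Lemma Cc_moment (om : R -> R) (v : E -> R) y k q T : continuous om -> continuous v ->
  Cc (fun x => v x * (om (x 0 ord_max) *
    ((height y x ^+ 2) ^+ k * pos_pow q.+1 (rad T y x)))).
Proof.
move=> com cv; apply: CcMl => //; apply: CcMl; first exact: continuous_last.
by apply: CcMl; [exact: (class_C_height2 0)|exact: Cc_pos_pow].
Qed.

Variables (a : R) (om : R -> R) (y : E).
Hypothesis com : continuous om.
Hypothesis dom : forall t, is_derive t (1 : R) (fun t => om t * (t - y 0 ord_max)) ((1 + a) * om t).

Let D k q T (i : 'I_m.+1) x :=
  cyl_r k y i x * (q.+3%:R * pos_pow q.+2 (rad T y x)) +
  cyl_h k y i x * pos_pow q.+3 (rad T y x).

Let H k q T (i : 'I_m.+1) x :=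
  (height y x ^+ 2) ^+ k * (- (2 * q.+3%:R) * pos_pow q.+2 (rad T y x) +
     4 * q.+3%:R * q.+2%:R * (x 0 i - y 0 i) ^+ 2 * pos_pow q.+1 (rad T y x)) +
  (i == ord_max)%:R * (2 * k%:R * (2 * k%:R - 1 + a) *
       ((height y x ^+ 2) ^+ k.-1 * pos_pow q.+3 (rad T y x)) -
     2 * q.+3%:R * (a + 4 * k%:R) * ((height y x ^+ 2) ^+ k * pos_pow q.+2 (rad T y x))).

(** In the last direction om is differentiated only through the product
om t * (t - h), whose derivative is (1 + a) * om t: the gradient of tau^(2k) r_+^p
carries a factor tau. *)
Lemma is_derive_flux k q T i x :
  is_derive x (delta_mx 0 i) (fun z : E => om (z 0 ord_max) * D k q T i z)
    (om (x 0 ord_max) * H k q T i x).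
Proof.
have dP j z : is_derive z (delta_mx 0 i) (fun z : E => pos_pow j.+2 (rad T y z))
    (j.+2%:R * pos_pow j.+1 (rad T y z) * (-2 * (z 0 i - y 0 i))).
  exact: is_derive_chain (is_derive_rad i T y z) (is_derive_pos_pow j _).
have [iE|iN] := eqVneq i ord_max; last first.
  have chE z : cyl_h k y i z = 0 by rewrite /cyl_h (negbTE iN).
  have dH := is_derive_height2 k y i x; rewrite chE in dH.
  have := is_derive_mul (is_derive_last_transverse om x iN)
    (is_derive_mul (is_derive_mul dH (is_derive_mull (-2) (is_derive_coordB i i (y 0 i) x)))
      (is_derive_mull q.+3%:R (dP q x))).
  rewrite eqxx => H1.
  have -> : (fun z : E => om (z 0 ord_max) * D k q T i z) =
     (fun z : E => om (z 0 ord_max) * ((height y z ^+ 2) ^+ k * (-2 * (z 0 i - y 0 i)) *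
       (q.+3%:R * pos_pow q.+2 (rad T y z)))).
    by apply/funext => z; rewrite /D chE mul0r addr0.
  by apply: (is_derive_eq H1); rewrite /H (negbTE iN) /= ?mulr0n ?mulr1n; ring.
have -> : (fun z : E => om (z 0 ord_max) * D k q T i z) =
   (fun z : E => om (z 0 ord_max) * (z 0 ord_max - y 0 ord_max) *
      (2 * k%:R * ((height y z ^+ 2) ^+ k.-1 * pos_pow q.+3 (rad T y z)) +
       - (2 * q.+3%:R) * ((height y z ^+ 2) ^+ k * pos_pow q.+2 (rad T y z)))).
  by apply/funext => z; rewrite /D /cyl_h /cyl_r iE eqxx /height; ring.
have := is_derive_mul (is_derive_chain (is_derive_coord i ord_max x) (dom _))
  (is_derive_add
    (is_derive_mull (2 * k%:R) (is_derive_mul (is_derive_height2 k.-1 y i x) (dP q.+1 x)))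
    (is_derive_mull (- (2 * q.+3%:R)) (is_derive_mul (is_derive_height2 k y i x) (dP q x)))).
move=> H1; apply: (is_derive_eq H1); rewrite /H /cyl_h iE eqxx -/(height y x).
move: (height y x) (pos_pow q.+3 _) (pos_pow q.+2 _) (pos_pow q.+1 _) (om _) => h P3 P2 P1 o.
case: k {H1} => [|[|k]] /=; rewrite ?mulr0n ?mulr1n; first by ring.
  by ring.
by rewrite !exprS -[k.+2%:R]natr1 -[k.+1%:R]natr1; ring.
Qed.

(** The sum of the squares of the coordinates of x - y equals T - r, and r times a
truncated power of r is the next truncated power; hence only truncated powers
remain. *)
Lemma sum_flux k q T x : \sum_i H k q T i x =
  2 * k%:R * (2 * k%:R - 1 + a) * ((height y x ^+ 2) ^+ k.-1 * pos_pow q.+3 (rad T y x)) +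
  4 * q.+3%:R * q.+2%:R * T * ((height y x ^+ 2) ^+ k * pos_pow q.+1 (rad T y x)) -
  q.+3%:R * (4 * q.+2%:R + 2 * (m.+1%:R + a) + 8 * k%:R) *
    ((height y x ^+ 2) ^+ k * pos_pow q.+2 (rad T y x)).
Proof.
have E1 : \sum_(i < m.+1) (i == ord_max)%:R = 1 :> R.
  by rewrite (bigD1 ord_max)//= eqxx big1 ?addr0// => i /negbTE ->.
have E2 : \sum_i (x 0 i - y 0 i) ^+ 2 = T - rad T y x by rewrite /rad; ring.
rewrite big_split /= -mulr_suml E1 mul1r -mulr_sumr big_split /= sumr_const card_ord.
under eq_bigr do rewrite -mulrA.
rewrite -mulr_sumr -mulr_suml E2 mulrBl pos_powS -mulr_natl; ring.
Qed.

(** Sum over i of the integrals of the i-th partial derivative of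
v * om * D_i (tau^(2k) r_+^p): the terms with a derivative of v add up to 0 by
the weak identity. *)
Lemma moment_relation (v : E -> R) (dv : 'I_m.+1 -> E -> R) k q T :
  continuous v -> (forall i, continuous (dv i)) ->
  (forall i x, is_derive x (delta_mx 0 i) v (dv i x)) ->
  weak_identity om dv y ->
  2 * k%:R * (2 * k%:R - 1 + a) * moment om v y k.-1 q.+3 T +
  4 * q.+3%:R * q.+2%:R * T * moment om v y k q.+1 T =
  q.+3%:R * (4 * q.+2%:R + 2 * (m.+1%:R + a) + 8 * k%:R) * moment om v y k q.+2 T.
Proof.
move=> cv cdv ddv Hw; have {}Hw := Hw k q T.
have cpp j : continuous (pos_pow (R := R) j) by exact: continuous_pos_pow.
have CD (U : E -> R) i : continuous U -> Cc (fun x => U x * (om (x 0 ord_max) * D k q T i x)).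
  move=> cU.
  apply: (@eq_Cc _ _ (fun x => U x * om (x 0 ord_max) * D k q T i x)); first by move=> x; rewrite mulrA.
  apply: (@Cc_cyl _ _ k T y i (fun x => U x * om (x 0 ord_max))
    (pos_pow q.+3) (fun r => q.+3%:R * pos_pow q.+2 r)).
  - move=> x; apply: (@continuousM _ _ U (fun x : E => om (x 0 ord_max))); first exact: cU.
    exact: continuous_last.
  - exact: cpp.
  - move=> r; apply: (@continuousM _ _ (fun=> q.+3%:R) (pos_pow q.+2)); last exact: cpp.
    exact: cst_continuous.
  - by move=> r r0; rewrite pos_pow_le0.
  - by move=> r r0; rewrite pos_pow_le0// mulr0.
have Cm j p := Cc_moment y j p T com cv.
have CH i : Cc (fun x => v x * (om (x 0 ord_max) * H k q T i x)).
  have c2 : continuous (fun x : E => (x 0 i - y 0 i) ^+ 2).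
    by apply: (class_C_pow (k := 0)); exact: (class_C_coordB 0).
  pose f j p x := v x * (om (x 0 ord_max) * ((height y x ^+ 2) ^+ j * pos_pow p (rad T y x))).
  apply: (@eq_Cc _ _ (fun x => (- (2 * q.+3%:R) * f k q.+2 x +
     4 * q.+3%:R * q.+2%:R * ((x 0 i - y 0 i) ^+ 2 * f k q.+1 x)) +
    ((i == ord_max)%:R * (2 * k%:R * (2 * k%:R - 1 + a)) * f k.-1 q.+3 x +
     - ((i == ord_max)%:R * (2 * q.+3%:R * (a + 4 * k%:R))) * f k q.+2 x))).
    by move=> x; rewrite /f /H; ring.
  apply: CcD; apply: CcD; apply: CcZ => //; try exact: Cm.
  by apply: CcMl => //; exact: Cm.
have E0 i : Rn_int (fun x => dv i x * (om (x 0 ord_max) * D k q T i x) +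
    v x * (om (x 0 ord_max) * H k q T i x)) = 0.
  apply: (@Rn_int_partial _ _ i (fun x => v x * (om (x 0 ord_max) * D k q T i x))).
  - exact: CD.
  - by apply: CcD => //; exact: CD.
  - by move=> x; exact: is_derive_mul (ddv i x) (is_derive_flux k q T i x).
have : Rn_int (fun x => \sum_i (dv i x * (om (x 0 ord_max) * D k q T i x) +
    v x * (om (x 0 ord_max) * H k q T i x))) = 0.
  rewrite Rn_int_sum; first by rewrite big1.
  by move=> i; apply: CcD => //; exact: CD.
rewrite (eq_Rn_int (g := fun x => (\sum_i om (x 0 ord_max) * dv i x * D k q T i x) +
  \sum_i (v x * (om (x 0 ord_max) * H k q T i x)))); last first.
  by move=> x; rewrite big_split /=; congr (_ + _); apply: eq_bigr => i _; ring.
rewrite Rn_intD; last 2 first.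
- apply: Cc_sum => i; apply: eq_Cc (CD (dv i) i (cdv i)) => x; ring.
- exact: Cc_sum.
rewrite Hw add0r.
rewrite (eq_Rn_int (g := fun x => (2 * k%:R * (2 * k%:R - 1 + a) * (v x * (om (x 0 ord_max) *
     ((height y x ^+ 2) ^+ k.-1 * pos_pow q.+3 (rad T y x)))) +
  4 * q.+3%:R * q.+2%:R * T * (v x * (om (x 0 ord_max) *
     ((height y x ^+ 2) ^+ k * pos_pow q.+1 (rad T y x))))) -
  q.+3%:R * (4 * q.+2%:R + 2 * (m.+1%:R + a) + 8 * k%:R) *
    (v x * (om (x 0 ord_max) * ((height y x ^+ 2) ^+ k * pos_pow q.+2 (rad T y x)))))); last first.
  by move=> x; rewrite -mulr_sumr -mulr_sumr sum_flux; ring.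
rewrite Rn_intB; [|by apply: CcD; apply: CcZ; exact: Cm|by apply: CcZ; exact: Cm].
rewrite Rn_intD; [|by apply: CcZ; exact: Cm|by apply: CcZ; exact: Cm].
rewrite !Rn_intZ; [|exact: Cm..].
by move/eqP; rewrite subr_eq0 => /eqP.
Qed.

End moment_relation.

(** * Euler equation and comparison of centers *)

Section radial_law.
Context {R : realType} {m : nat}.
Notation E := 'rV[R]_m.+1.
Implicit Types x y : E.

Lemma exprn_tangent (b c : R) n : 0 <= b -> 0 <= c ->
  n.+1%:R * c ^+ n * (b - c) <= b ^+ n.+1 - c ^+ n.+1.
Proof.
move=> b0 c0; elim: n => [|n IH]; first by rewrite !expr1 expr0 !mul1r.
have := ler_wpM2l b0 IH.
have : 0 <= n.+1%:R * c ^+ n * (b - c) ^+ 2.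
  by rewrite mulr_ge0 ?sqr_ge0// mulr_ge0// exprn_ge0.
rewrite -subr_ge0 => H1; rewrite -subr_ge0 => H2; rewrite -subr_ge0.
apply: le_trans (addr_ge0 H1 H2) _; rewrite le_eqVlt; apply/orP; left; apply/eqP.
by rewrite subr0 !exprS -[n.+2%:R]natr1; ring.
Qed.

Lemma exprn_lipschitz (b c M : R) n : 0 <= b <= M -> 0 <= c <= M ->
  `|b ^+ n.+1 - c ^+ n.+1| <= n.+1%:R * M ^+ n * `|b - c|.
Proof.
move=> /andP[b0 bM] /andP[c0 cM]; have M0 : 0 <= M by exact: le_trans bM.
elim: n => [|n IH]; first by rewrite !expr1 expr0 !mul1r.
have -> : b ^+ n.+2 - c ^+ n.+2 = b * (b ^+ n.+1 - c ^+ n.+1) + c ^+ n.+1 * (b - c).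
  by rewrite !exprS; ring.
apply: le_trans (ler_normD _ _) _; rewrite !normrM.
have -> : n.+2%:R * M ^+ n.+1 * `|b - c| =
    M * (n.+1%:R * M ^+ n * `|b - c|) + M ^+ n.+1 * `|b - c|.
  by rewrite !exprS -[n.+2%:R]natr1; ring.
apply: lerD; first by apply: ler_pM => //; rewrite ger0_norm.
by apply: ler_wpM2r => //; rewrite ger0_norm ?exprn_ge0// lerXn2r// nnegrE.
Qed.

(** Convexity of truncated powers. *)
Lemma pos_pow_tangent n (r s : R) :
  n.+2%:R * pos_pow n.+1 r * (s - r) <= pos_pow n.+2 s - pos_pow n.+2 r.
Proof.
have [r0|r0] := leP r 0.
  by rewrite !(pos_pow_le0 _ r0) mulr0 mul0r subr0 pos_pow_ge0.
apply: le_trans (_ : _ <= n.+2%:R * Num.max r 0 ^+ n.+1 * (Num.max s 0 - Num.max r 0)) _.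
  rewrite /pos_pow; apply: ler_wpM2l.
    by rewrite mulr_ge0// exprn_ge0// le_max lexx orbT.
  by rewrite lerB// ?le_max ?lexx// ge_max lexx ltW.
by apply: exprn_tangent; rewrite le_max lexx orbT.
Qed.

(** The convexity inequality from r to r + h and from r + h to r encloses the
error between 0 and a difference of truncated powers of lower order times h.
The last factor, which is at least 1 when r + 1 >= 0, keeps track of the support. *)
Lemma pos_pow_quadratic n (r h M : R) : 0 <= M -> r + 1 <= M -> `|h| < 1 ->
  `|pos_pow n.+2 (r + h) - pos_pow n.+2 r - h * (n.+2%:R * pos_pow n.+1 r)| <=
  n.+2%:R * (n.+1%:R * M ^+ n) * h ^+ 2 * pos_pow 1 (r + 2).
Proof.
move=> M0 rM h1.
have hn : - 1 < h < 1 by rewrite -ltr_norml.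
have [r1|r1] := leP (r + 1) 0.
  have rh : r + h <= 0 by lra.
  have r0 : r <= 0 by lra.
  rewrite (pos_pow_le0 _ rh) !(pos_pow_le0 _ r0).
  rewrite !(subr0, mulr0) normr0 mulr_ge0 ?pos_pow_ge0// mulr_ge0 ?sqr_ge0//.
  by rewrite !mulr_ge0// exprn_ge0.
have L := pos_pow_tangent n r (r + h); have U := pos_pow_tangent n (r + h) r.
have -> : h * (n.+2%:R * pos_pow n.+1 r) = n.+2%:R * pos_pow n.+1 r * (r + h - r) by ring.
rewrite ger0_norm ?subr_ge0//.
apply: (@le_trans _ _ (n.+2%:R * (h * (pos_pow n.+1 (r + h) - pos_pow n.+1 r)))).
  move: U; set p1 := pos_pow n.+1 _; set p2 := pos_pow n.+1 r; rewrite -subr_ge0 => U.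
  by rewrite -subr_ge0; apply: le_trans U _; rewrite le_eqVlt; apply/orP; left; apply/eqP; ring.
have -> : n.+2%:R * (n.+1%:R * M ^+ n) * h ^+ 2 * pos_pow 1 (r + 2) =
  n.+2%:R * (n.+1%:R * (M ^+ n * (h ^+ 2 * pos_pow 1 (r + 2)))) by ring.
apply: ler_wpM2l => //.
apply: (@le_trans _ _ (n.+1%:R * (M ^+ n * h ^+ 2))); last first.
  apply: ler_wpM2l => //; apply: ler_wpM2l; first exact: exprn_ge0.
  rewrite -[leLHS]mulr1; apply: ler_wpM2l; first exact: sqr_ge0.
  by rewrite /pos_pow expr1 le_max; apply/orP; left; lra.
apply: le_trans (ler_norm _) _; rewrite normrM.
have -> : n.+1%:R * (M ^+ n * h ^+ 2) = `|h| * (n.+1%:R * M ^+ n * `|h|).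
  by rewrite -real_normK ?num_real//; ring.
rewrite ler_wpM2l//.
have mx t : 0 <= Num.max t 0 :> R by rewrite le_max lexx orbT.
apply: le_trans (exprn_lipschitz (M := M) _ _ _) _.
- by rewrite mx /= ge_max M0 andbT; lra.
- by rewrite mx /= ge_max M0 andbT; lra.
rewrite ler_wpM2l ?mulr_ge0 ?exprn_ge0//.
rewrite ler_norml !maxEle.
by case: (leP (r + h) 0) => ?; case: (leP r 0) => ?;
  have := ler_norm h; have := ler_norm (- h); rewrite normrN; lra.
Qed.

Lemma is_derive_Rn_int_pos_pow (W : E -> R) y q T : continuous W ->
  is_derive T (1 : R) (fun T => Rn_int (fun x => W x * pos_pow q.+2 (rad T y x)))
    (q.+2%:R * Rn_int (fun x => W x * pos_pow q.+1 (rad T y x))).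
Proof.
move=> cW; pose M := `|T| + 1.
have M0 : 0 <= M by rewrite addr_ge0.
pose C := q.+2%:R * (q.+1%:R * M ^+ q).
have CW j T' : Cc (fun x => W x * pos_pow j.+1 (rad T' y x)).
  by apply: CcMl => //; exact: Cc_pos_pow.
have CWn : Cc (fun x => `|W x| * pos_pow 1 (rad (T + 2) y x)).
  apply: CcMl; last exact: Cc_pos_pow.
  by move=> x; apply: continuous_comp; [exact: cW|exact: norm_continuous].
apply: (@is_derive_quadratic _ _ _ _ (C * Rn_int (fun x => `|W x| * pos_pow 1 (rad (T + 2) y x)))).
move=> h h1; rewrite -Rn_intB// [h * _]mulrA -Rn_intZ// -Rn_intB//; [|exact: CcB|exact: CcZ].
rewrite [leRHS]mulrAC -Rn_intZ//.
apply: ler_norm_Rn_int; [by apply: CcB; [exact: CcB|exact: CcZ]|exact: CcZ|].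
move=> x; have -> : rad (h + T) y x = rad T y x + h by rewrite /rad; ring.
have -> : rad (T + 2) y x = rad T y x + 2 by rewrite /rad; ring.
have rM : rad T y x + 1 <= M.
  by rewrite lerD2r; apply: le_trans (rad_le T y x) (ler_norm _).
have := pos_pow_quadratic q M0 rM h1.
set p1 := pos_pow q.+2 (_ + h); set p2 := pos_pow q.+2 _; set p3 := pos_pow q.+1 _.
set p4 := pos_pow 1 _ => H.
have -> : W x * p1 - W x * p2 - h * q.+2%:R * (W x * p3) =
   W x * (p1 - p2 - h * (q.+2%:R * p3)) by ring.
by rewrite normrM [leRHS]mulrCA; exact: ler_wpM2l.
Qed.

(** The hypotheses make T A'(T) = beta A(T) for T > 0. In the variable
T = exp t this is a linear equation on the whole line. *)
Lemma radial_law (A B : R -> R) (c beta : R) :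
  (forall T, is_derive T (1 : R) A (c * B T)) ->
  (forall T, 0 < T -> c * T * B T = beta * A T) ->
  forall t, A (expR t) = A 1 * expR (beta * t).
Proof.
move=> dA AB t.
have dg (s : R) : is_derive s (1 : R) (fun s => A (expR s) * expR (- beta * s)) 0.
  have H := is_derive_mul (is_derive_chain (is_derive_expR s) (dA (expR s)))
    (is_derive_chain (is_derive_mull (- beta) (is_derive_id s (1 : R))) (is_derive_expR _)).
  apply: (is_derive_eq H).
  rewrite (_ : c * B (expR s) * expR s = beta * A (expR s)); last by rewrite -AB ?expR_gt0//; ring.
  ring.
have := is_derive_0_is_cst t 0 dg; rewrite !mulr0 expR0 mulr1 => <-.
by rewrite -mulrA -expRD mulNr addNr expR0 mulr1.
Qed.

(** From |x - y2|^2 <= (1 + delta) |x - y1|^2 + (1 + 1/delta) |y1 - y2|^2. The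
radius grows by a factor 1 + 2 delta that is as close to 1 as desired,
provided that T is large. *)
Lemma rad_shift (y1 y2 x : E) T delta : 0 < delta ->
  (1 + delta^-1) * \sum_i (y1 0 i - y2 0 i) ^+ 2 <= delta * T ->
  0 <= rad T y1 x -> rad T y1 x <= rad (T * (1 + 2 * delta)) y2 x.
Proof.
move=> d0 Hd; rewrite /rad.
have : \sum_i (x 0 i - y2 0 i) ^+ 2 <= (1 + delta) * \sum_i (x 0 i - y1 0 i) ^+ 2 +
    (1 + delta^-1) * \sum_i (y1 0 i - y2 0 i) ^+ 2.
  rewrite !mulr_sumr -big_split /=; apply: ler_sum => i _.
  set A := x 0 i; set B := y1 0 i; set C := y2 0 i; rewrite -subr_ge0.
  have -> : (1 + delta) * (A - B) ^+ 2 + (1 + delta^-1) * (B - C) ^+ 2 - (A - C) ^+ 2 =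
     delta^-1 * (delta * (A - B) - (B - C)) ^+ 2.
    by field; rewrite gt_eqF.
  by rewrite mulr_ge0 ?sqr_ge0// invr_ge0 ltW.
move: Hd; move: (\sum_i (x 0 i - y2 0 i) ^+ 2) (\sum_i (x 0 i - y1 0 i) ^+ 2) (_ * \sum_i _).
move=> s2 s1 D HD H1 H2.
have : delta * s1 <= delta * T by rewrite ler_pM2l//; lra.
by lra.
Qed.

Lemma pos_pow_le q (r s : R) : r <= s -> pos_pow q r <= pos_pow q s.
Proof.
move=> rs; apply: lerXn2r; [by rewrite nnegrE le_max lexx orbT..|].
by rewrite ge_max !le_max rs lexx orbT.
Qed.

Lemma moment_shift (om : R -> R) (u : E -> R) (y1 y2 : E) q T delta :
  continuous om -> (forall t, 0 <= om t) -> continuous u -> (forall x, 0 <= u x) ->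
  0 < delta -> (1 + delta^-1) * \sum_i (y1 0 i - y2 0 i) ^+ 2 <= delta * T ->
  moment om u y1 0 q.+1 T <= moment om u y2 0 q.+1 (T * (1 + 2 * delta)).
Proof.
move=> com om0 cu u0 d0 HT; apply: le_Rn_int; [exact: Cc_moment..|move=> x].
rewrite !expr0 !mul1r ler_wpM2l// ler_wpM2l//.
have [r0|r0] := leP (rad T y1 x) 0; first by rewrite pos_pow_le0// pos_pow_ge0.
by apply: pos_pow_le; apply: rad_shift => //; exact: ltW.
Qed.

(** The moments around y1 at T are at most those around y2 at T exp eta, for any
eta > 0 and T large: g1 <= g2 * exp (beta * eta), and eta tends to 0. *)
Lemma moment_center (om : R -> R) (u : E -> R) (y1 y2 : E) (g1 g2 beta : R) q :
  continuous om -> (forall t, 0 <= om t) -> continuous u -> (forall x, 0 <= u x) ->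
  0 < beta ->
  (forall t, moment om u y1 0 q.+1 (expR t) = g1 * expR (beta * t)) ->
  (forall t, moment om u y2 0 q.+1 (expR t) = g2 * expR (beta * t)) ->
  g1 <= g2.
Proof.
move=> com om0 cu u0 b0 H1 H2.
have g10 : 0 <= g1.
  have := H1 0; rewrite mulr0 expR0 mulr1 => <-; apply: Rn_int_ge0; first exact: Cc_moment.
  by move=> x; rewrite !mulr_ge0// ?pos_pow_ge0// exprn_ge0// sqr_ge0.
have key eta : 0 < eta -> g1 <= g2 * expR (beta * eta).
  (* So that T * (1 + 2 * delta) = T * expR eta; T is then taken so large that
     moment_shift applies. *)
  move=> e0; pose delta := (expR eta - 1) / 2.
  have d0 : 0 < delta by have := expR_gt1Dx (lt0r_neq0 e0); rewrite /delta; lra.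
  have dE : 1 + 2 * delta = expR eta by rewrite /delta; field.
  pose S := (1 + delta^-1) * \sum_i (y1 0 i - y2 0 i) ^+ 2.
  pose t := S / delta.
  have HT : S <= delta * expR t.
    have := expR_ge1Dx t; rewrite -(ler_pM2l d0); apply: le_trans.
    by rewrite mulrDr /t mulrCA divff ?gt_eqF//; lra.
  have := moment_shift q com om0 cu u0 d0 HT.
  rewrite dE -expRD H1 H2 mulrDr expRD mulrA mulrAC.
  by rewrite ler_pM2r ?expR_gt0.
apply/ler_addgt0Pr => e e0.
have b1 : 0 < beta * (g1 + 1) by rewrite mulr_gt0// ltr_wpDl.
have H := key (e / (beta * (g1 + 1))) (divr_gt0 e0 b1).
rewrite (_ : beta * (e / (beta * (g1 + 1))) = e / (g1 + 1)) in H; last first.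
  by field; rewrite !gt_eqF// ltr_wpDl.
set z := e / (g1 + 1) in H.
have zE : g1 * z <= e.
  by rewrite /z mulrCA -[leRHS]mulr1 ler_wpM2l ?(ltW e0)// ler_pdivrMr ?ltr_wpDl//; lra.
have : g1 * expR (- z) <= g2.
  by rewrite -(ler_pM2r (expR_gt0 z)) -mulrA -expRD addNr expR0 mulr1.
have := ler_wpM2l g10 (expR_ge1Dx (- z)); lra.
Qed.

End radial_law.

(** * Vanishing of all moments *)

Section vanishing_moments.
Context {R : realType} {m : nat}.
Notation E := 'rV[R]_m.+1.
Implicit Types x y : E.
Variables (a : R) (om : R -> R).
Hypothesis a0 : 0 <= a.
Hypothesis com : continuous om.
Hypothesis om0 : forall t, 0 <= om t.

(** The points around which the mean value property will hold: the weight has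
the right homogeneity in the distance to the hyperplane through y, and the weak
identity holds. *)
Definition center (du : 'I_m.+1 -> E -> R) y : Prop :=
  (forall t, is_derive t (1 : R) (fun t => om t * (t - y 0 ord_max)) ((1 + a) * om t)) /\
  weak_identity om du y.

(** The degree of homogeneity in T of the moment with tau^(2k) and r_+^2. *)
Definition degree (k : nat) : R := 2 + (m.+1%:R + a) / 2 + 2 * k%:R.

Lemma degree_gt0 k : 0 < degree k.
Proof. by rewrite /degree -addrA ltr_wpDr// addr_ge0// ?mulr_ge0// ?divr_ge0// addr_ge0. Qed.

Lemma moment_le0 (v : E -> R) y k q T : T <= 0 -> moment om v y k q.+1 T = 0.
Proof.
move=> T0; rewrite /moment (eq_Rn_int (g := fun=> 0)) ?Rn_int0// => x.
by rewrite pos_pow_le0 ?mulr0// (le_trans (rad_le T y x)).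
Qed.

Lemma moment_is_derive (v : E -> R) y k T : continuous v ->
  is_derive T (1 : R) (moment om v y k 2) (2 * moment om v y k 1 T).
Proof.
move=> cv.
pose W x := v x * (om (x 0 ord_max) * (height y x ^+ 2) ^+ k).
have cW : continuous W.
  move=> x; apply: (@continuousM _ _ v (fun x : E => om (x 0 ord_max) * (height y x ^+ 2) ^+ k)); first exact: cv.
  apply: (@continuousM _ _ (fun x : E => om (x 0 ord_max))); first exact: continuous_last.
  exact: (class_C_height2 0).
have WE q : moment om v y k q = (fun T => Rn_int (fun x => W x * pos_pow q (rad T y x))).
  by apply/funext => T'; apply: eq_Rn_int => x; rewrite /W !mulrA.
by rewrite !WE; exact: is_derive_Rn_int_pos_pow.
Qed.

Section one_function.
Variables (v : E -> R) (dv : 'I_m.+1 -> E -> R) (y : E).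
Hypothesis cv : continuous v.
Hypothesis cdv : forall i, continuous (dv i).
Hypothesis ddv : forall i x, is_derive x (delta_mx 0 i) v (dv i x).
Hypothesis Cy : center dv y.

(** Without the moment of order k - 1 the relation is an Euler equation. *)
Lemma moment_law k : ((0 < k)%N -> forall T, moment om v y k.-1 3 T = 0) ->
  forall t, moment om v y k 2 (expR t) = moment om v y k 2 1 * expR (degree k * t).
Proof.
move=> Hk; apply: (radial_law (c := 2) (B := moment om v y k 1)).
  by move=> T; exact: moment_is_derive.
move=> T T0; have [dy wy] := Cy; have := moment_relation com dy k 0 T cv cdv ddv wy.
have -> : 2 * k%:R * (2 * k%:R - 1 + a) * moment om v y k.-1 3 T = 0.
  by case: k Hk => [|k] Hk; [rewrite mulr0n !(mulr0, mul0r)|rewrite Hk// mulr0].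
rewrite add0r /degree => H.
apply: (@mulfI _ (12%:R : R)); first by rewrite pnatr_eq0.
move: H; rewrite (_ : 4 * 3 * 2 * T * _ = 12%:R * (2 * T * moment om v y k 1 T)); last by ring.
by move=> ->; field.
Qed.

(** The relation at a given T links consecutive exponents with positive
coefficients, so the vanishing of one moment entails that of the others. *)
Lemma moment_all_powers k : ((0 < k)%N -> forall q T, moment om v y k.-1 q.+1 T = 0) ->
  (forall t, moment om v y k 2 (expR t) = 0) ->
  forall q T, moment om v y k q.+1 T = 0.
Proof.
move=> Hk H2 q T; have [T0|T0] := leP T 0; first exact: moment_le0.
have [dy wy] := Cy; have rel j := moment_relation com dy k j T cv cdv ddv wy.
have Z j : 2 * k%:R * (2 * k%:R - 1 + a) * moment om v y k.-1 j.+1 T = 0.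
  by case: k Hk {H2 rel} => [|k] Hk; [rewrite mulr0n !(mulr0, mul0r)|rewrite Hk// mulr0].
elim: q => [|q IH].
  have := rel 0%N; rewrite Z add0r -(lnK T0) H2 lnK// mulr0 => /eqP.
  rewrite mulf_eq0 => /orP[|/eqP//].
  by rewrite !mulf_eq0 !pnatr_eq0 /= gt_eqF.
have := rel q; rewrite Z add0r IH mulr0 => /esym/eqP.
rewrite mulf_eq0 => /orP[|/eqP//].
rewrite mulf_eq0 pnatr_eq0 /= gt_eqF//.
by rewrite -addrA ltr_wpDr ?mulr_gt0// addr_ge0// ?mulr_ge0// addr_ge0.
Qed.

(** On the support of r_+ the height is at most T^(1/2). *)
Lemma moment_growth (b : E -> R) k T : continuous b -> (forall x, `|v x| <= b x) ->
  0 <= T -> `|moment om v y k 2 T| <= T ^+ k * moment om b y 0 2 T.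
Proof.
move=> cb vb T0; rewrite /moment -Rn_intZ; last exact: Cc_moment.
apply: ler_norm_Rn_int; [exact: Cc_moment|by apply: CcZ; exact: Cc_moment|].
move=> x; rewrite expr0 mul1r; have [r0|r0] := leP (rad T y x) 0.
  by rewrite pos_pow_le0// !mulr0 normr0.
have h0 : 0 <= (height y x ^+ 2) ^+ k by rewrite exprn_ge0// sqr_ge0.
have -> : T ^+ k * (b x * (om (x 0 ord_max) * pos_pow 2 (rad T y x))) =
  b x * (om (x 0 ord_max) * (T ^+ k * pos_pow 2 (rad T y x))) by ring.
have Z0 : 0 <= om (x 0 ord_max) * ((height y x ^+ 2) ^+ k * pos_pow 2 (rad T y x)).
  by apply: mulr_ge0 => //; apply: mulr_ge0 => //; exact: pos_pow_ge0.
rewrite normrM [X in _ * X]ger0_norm//.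
apply: ler_pM => //.
apply: ler_wpM2l => //; apply: ler_wpM2r; first exact: pos_pow_ge0.
apply: lerXn2r; rewrite ?nnegrE ?sqr_ge0//.
by apply: rad_coord; exact: ltW.
Qed.

(** For the moments of order j = k + 1, law and growth give two different
degrees, degree 0 + 2j and degree 0 + j, so that the coefficient g of the law
satisfies |g| <= C * exp (- j * t) for all t. The bound b has to obey the law
itself; u + |c| will do for u - c. *)
Lemma moment_vanish_step (b : E -> R) C k :
  continuous b -> (forall x, `|v x| <= b x) ->
  (forall t, moment om b y 0 2 (expR t) = C * expR (degree 0 * t)) ->
  (forall q T, moment om v y k q.+1 T = 0) ->
  forall q T, moment om v y k.+1 q.+1 T = 0.
Proof.
move=> cb vb Hb Hk; apply: moment_all_powers => // t.
rewrite moment_law//; set g := moment _ _ _ _ _ 1.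
have key s : 0 <= s -> `|g| * (1 + s) <= C.
  move=> s0; have := moment_growth k.+1 cb vb (expR_ge0 s).
  rewrite moment_law// Hb -/g normrM (ger0_norm (expR_ge0 _)).
  have -> : degree k.+1 * s = degree 0 * s + (k.+1%:R * s + k.+1%:R * s).
    by rewrite /degree; ring.
  rewrite -expRM_natl !expRD.
  set e0 := expR (degree 0 * s); set e1 := expR (k.+1%:R * s) => H.
  have {}H : `|g| * e1 <= C.
    rewrite -(ler_pM2r (mulr_gt0 (expR_gt0 (degree 0 * s)) (expR_gt0 (k.+1%:R * s)))).
    rewrite -/e0 -/e1 (_ : _ * _ * _ = `|g| * (e0 * (e1 * e1))); last by ring.
    by rewrite (_ : C * (e0 * e1) = e1 * (C * e0))//; ring.
  apply: le_trans H; apply: ler_wpM2l => //.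
  apply: le_trans (expR_ge1Dx _) _; rewrite ler_expR -[leLHS]mul1r.
  by rewrite ler_wpM2r// ler1n.
suff -> : g = 0 by rewrite mul0r.
apply/eqP; rewrite -normr_le0 leNgt; apply/negP => g0.
have C0 : 0 <= C by have := key 0 (lexx _); rewrite addr0 mulr1; exact: le_trans.
(* At s = C / |g| the bound reads |g| + C <= C. *)
have := key (C / `|g|) (divr_ge0 C0 (ltW g0)).
by rewrite mulrDr mulr1 mulrCA divff ?gt_eqF// mulr1; lra.
Qed.

End one_function.

Lemma weak_identity0 y : weak_identity om (fun (_ : 'I_m.+1) (_ : E) => 0) y.
Proof.
move=> k q T; rewrite (eq_Rn_int (g := fun=> 0)) ?Rn_int0// => x.
by rewrite big1// => i _; rewrite mulr0 mul0r.
Qed.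

Lemma momentD (v1 v2 : E -> R) y k q T : continuous v1 -> continuous v2 ->
  moment om (fun x => v1 x + v2 x) y k q.+1 T =
  moment om v1 y k q.+1 T + moment om v2 y k q.+1 T.
Proof.
move=> c1 c2; rewrite /moment -Rn_intD; [|exact: Cc_moment..].
by apply: eq_Rn_int => x; rewrite mulrDl.
Qed.

Lemma moment_cst c y k q T :
  moment om (fun=> c) y k q.+1 T = c * moment om (fun=> 1) y k q.+1 T.
Proof.
rewrite /moment -Rn_intZ; last by apply: Cc_moment => // x; exact: cst_continuous.
by apply: eq_Rn_int => x; rewrite mul1r.
Qed.

(** The constant c is the quotient of the coefficients of u and 1 in the law for
k = 0; by comparison of centers they do not depend on the center. *)
Lemma moments_vanish (u : E -> R) (du : 'I_m.+1 -> E -> R) y0 :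
  continuous u -> (forall x, 0 <= u x) -> (forall i, continuous (du i)) ->
  (forall i x, is_derive x (delta_mx 0 i) u (du i x)) ->
  center du y0 -> 0 < moment om (fun=> 1) y0 0 2 1 ->
  exists c, forall y, center du y ->
    forall k q T, moment om (fun x => u x - c) y k q.+1 T = 0.
Proof.
move=> cu u0 cdu ddu Cy0 g10.
have c1 : continuous (fun _ : E => 1 : R) by move=> x; exact: cst_continuous.
have cc c : continuous (fun _ : E => c : R) by move=> x; exact: cst_continuous.
have law_u y : center du y -> forall t,
    moment om u y 0 2 (expR t) = moment om u y 0 2 1 * expR (degree 0 * t).
  by move=> Cy; apply: (moment_law cu cdu ddu Cy).
have law_1 y : center du y -> forall t,
    moment om (fun=> 1) y 0 2 (expR t) = moment om (fun=> 1) y 0 2 1 * expR (degree 0 * t).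
  move=> [dy _]; apply: (@moment_law _ (fun _ _ => 0) y) => //.
  by split => //; exact: weak_identity0.
have Eu y : center du y -> moment om u y 0 2 1 = moment om u y0 0 2 1.
  move=> Cy; apply/eqP; rewrite eq_le; apply/andP; split.
    by apply: (moment_center (q := 1) com om0 cu u0 (degree_gt0 0) (law_u _ Cy) (law_u _ Cy0)).
  by apply: (moment_center (q := 1) com om0 cu u0 (degree_gt0 0) (law_u _ Cy0) (law_u _ Cy)).
have E1 y : center du y -> moment om (fun=> 1) y 0 2 1 = moment om (fun=> 1) y0 0 2 1.
  move=> Cy; apply/eqP; rewrite eq_le; apply/andP; split.
    by apply: (moment_center (q := 1) com om0 c1 (fun=> ler01) (degree_gt0 0) (law_1 _ Cy) (law_1 _ Cy0)).
  by apply: (moment_center (q := 1) com om0 c1 (fun=> ler01) (degree_gt0 0) (law_1 _ Cy0) (law_1 _ Cy)).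
pose c := moment om u y0 0 2 1 / moment om (fun=> 1) y0 0 2 1.
have cuc d : continuous (fun x => u x + d).
  by move=> x; exact: (continuousD (cu x) (cc d x)).
have law_ud d y : center du y -> forall t, moment om (fun x => u x + d) y 0 2 (expR t) =
    (moment om u y0 0 2 1 + d * moment om (fun=> 1) y0 0 2 1) * expR (degree 0 * t).
  move=> Cy t; rewrite momentD// moment_cst law_u// law_1// Eu// E1//; ring.
exists c => y Cy.
have dv i x : is_derive x (delta_mx 0 i) (fun x => u x - c) (du i x).
  have H := is_derive_add (ddu i x) (is_derive_cst (- c) x (delta_mx 0 i)).
  by apply: (is_derive_eq H); rewrite addr0.
have cv : continuous (fun x => u x - c) by exact: (cuc (- c)).
elim=> [|k IH].
  apply: (moment_all_powers cv cdu dv Cy) => // t.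
  by rewrite law_ud// /c mulNr divfK ?gt_eqF// subrr mul0r.
apply: (moment_vanish_step cv cdu dv Cy (cuc `|c|) _ (law_ud `|c| y Cy) IH).
move=> x; apply: le_trans (ler_normB _ _) _.
by rewrite ger0_norm.
Qed.

End vanishing_moments.

(** * The half-space weight, and concentration at a pole *)

Section half_line_weight.
Context {R : realType}.
Variable a : R.
Hypothesis a_gt0 : 0 < a.

(** Half of the weight |x|^a; it is continuous at 0 because a > 0. *)
Definition half_pow (x : R) : R := Num.max x 0 `^ a.

Lemma half_pow_le0 x : x <= 0 -> half_pow x = 0.
Proof. by move=> x0; rewrite /half_pow max_r// powR0// gt_eqF. Qed.

Lemma half_pow_ge x : 0 <= x -> half_pow x = x `^ a.
Proof. by move=> x0; rewrite /half_pow max_l. Qed.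

Lemma half_pow_ge0 x : 0 <= half_pow x.
Proof. exact: powR_ge0. Qed.

Lemma half_pow_mono x y : x <= y -> half_pow x <= half_pow y.
Proof.
move=> xy; apply: ge0_ler_powR; [exact: ltW|by rewrite nnegrE le_max lexx orbT..|].
by rewrite ge_max !le_max xy lexx orbT.
Qed.

Lemma half_pow_small e : 0 < e -> exists2 d, 0 < d & half_pow d <= e.
Proof.
move=> e0; exists (e `^ a^-1); first exact: powR_gt0.
rewrite half_pow_ge ?powR_ge0// -powRrM mulVf ?gt_eqF// powRr1//; exact: ltW.
Qed.

Lemma continuous_half_pow : continuous half_pow.
Proof.
move=> x; have [x0|x0|x0] := ltgtP x 0.
- apply: (@is_derive_continuous1 _ _ _ 0).
  apply: (@near_eq_is_derive _ _ _ (fun=> 0)).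
  near=> z; rewrite half_pow_le0// ltW//; near: z; exact: lt_nbhsl.
- apply: (@is_derive_continuous1 _ _ _ (a * x `^ (a - 1))).
  apply: (near_eq_is_derive _ (is_derive1_powR a x0)).
  near=> z; rewrite half_pow_ge// ltW//; near: z; exact: lt_nbhsr.
- rewrite x0; apply: dist_continuous => e e0.
  have e20 : 0 < e / 2 by rewrite divr_gt0.
  have [d d0 Hd] := half_pow_small e20.
  exists d => // y; rewrite subr0 => yd.
  rewrite (half_pow_le0 (lexx 0)) subr0 ger0_norm ?half_pow_ge0//.
  have : half_pow y <= half_pow d.
    by apply: half_pow_mono; apply: ltW; apply: le_lt_trans yd; exact: ler_norm.
  by lra.
Unshelve. all: by end_near. Qed.

Lemma is_derive_mul_id (g : R -> R) : {for 0, continuous g} ->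
  is_derive (0 : R) (1 : R) (fun x => g x * x) (g 0).
Proof.
move=> cg.
suff L : (fun h : R => h^-1 *: (g (h *: (1 : R) + 0) * (h *: (1 : R) + 0) - g 0 * 0)) @ (0 : R)^' --> g 0.
  by split; [apply/cvg_ex; exists (g 0)|apply: cvg_lim].
apply/cvgrPdist_lt => e /(continuous_dist cg)[d d0 Hd].
near=> h.
have h0 : h != 0 by near: h; exact: nbhs_dnbhs_neq.
have hd : `|h| < d by near: h; apply: dnbhs0_lt.
rewrite [h *: 1]mulr1 addr0 mulr0 subr0 -[_ *: _]/(h^-1 * _) mulrCA mulVf// mulr1 distrC.
by apply: Hd; rewrite subr0.
Unshelve. all: by end_near. Qed.

(** At 0, x_+^a itself may fail to be differentiable, but its product with x is. *)
Lemma is_derive_half_pow_mul x :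
  is_derive x (1 : R) (fun x => half_pow x * x) ((1 + a) * half_pow x).
Proof.
have [x0|x0|x0] := ltgtP x 0.
- rewrite half_pow_le0 ?ltW// mulr0.
  apply: (@near_eq_is_derive _ _ _ (fun=> 0)).
  near=> z; rewrite half_pow_le0 ?mul0r// ltW//; near: z; exact: lt_nbhsl.
- have D := is_derive_mul (is_derive1_powR a x0) (is_derive_id x (1 : R)).
  have D' : is_derive x (1 : R) (fun x => x `^ a * x) ((1 + a) * half_pow x).
    apply: (is_derive_eq D); rewrite half_pow_ge ?ltW//.
    have -> : x `^ a = x `^ (a - 1) * x.
      rewrite -[X in _ * X]powRr1 ?ltW// -powRD; last by rewrite (gt_eqF x0) implybT.
      by rewrite subrK.
    ring.
  apply: near_eq_is_derive D'.
  near=> z; rewrite half_pow_ge// ltW//; near: z; exact: lt_nbhsr.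
- rewrite x0 (half_pow_le0 (lexx 0)) mulr0.
  have := is_derive_mul_id (@continuous_half_pow 0).
  by rewrite (half_pow_le0 (lexx 0)).
Unshelve. all: by end_near. Qed.

Variable s : R.
Hypothesis ss : s * s = 1.

(** Here s stands for a sign, 1 or -1, that selects one of the half-lines. *)
Definition side_weight (t : R) : R := half_pow (s * t).

Lemma continuous_side_weight : continuous side_weight.
Proof.
move=> t; apply: (@continuous_comp _ _ _ (fun t : R => s * t)); last exact: continuous_half_pow.
by apply: continuousM; [exact: cst_continuous|exact: cvg_id].
Qed.

Lemma is_derive_side_weight t :
  is_derive t (1 : R) (fun t => side_weight t * (t - 0)) ((1 + a) * side_weight t).
Proof.
have D := is_derive_mull s (is_derive_chain (is_derive_mull s (is_derive_id t (1 : R)))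
  (is_derive_half_pow_mul (s * t))).
have -> : (fun t : R => side_weight t * (t - 0)) =
    (fun t : R => s * (half_pow (s * t) * (s * t))).
  by apply/funext => z; rewrite subr0 /side_weight mulrCA [s * (s * z)]mulrA ss mul1r.
apply: (is_derive_eq D); rewrite /side_weight mulr1 mulrCA ss mulr1//.
Qed.

Lemma norm_side : `|s| = 1.
Proof.
have : `|s| ^+ 2 = 1 by rewrite real_normK ?num_real// expr2.
by move/eqP; rewrite sqrf_eq1 => /orP[/eqP//|/eqP]; have := normr_ge0 s; lra.
Qed.

Lemma abs_pow_side t : 0 < s * t -> `|t| `^ a = half_pow (s * t).
Proof.
move=> st; rewrite half_pow_ge ?ltW// -[in RHS](gtr0_norm st).
by rewrite normrM norm_side mul1r.
Qed.

(** With x = s t and G = exp (- eps / x), the derivative eps / x^2 * exp (- eps / x)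
of G is not bounded in eps. For x <= eta the weight x^a is at most kap; for
x > eta the derivative is at most eps / eta^2. It is here that a > 0 is used: the
flux through the hyperplane vanishes in the limit. *)
Lemma cutoff_limit_side m : @cutoff_limit R m (fun t => `|t| `^ a) side_weight.
Proof.
move=> B kap k0.
have [eta0 e00 He0] := half_pow_small k0.
pose eta := Num.min eta0 1.
have e0 : 0 < eta by rewrite lt_min e00 ltr01.
have e1 : eta <= 1 by rewrite ge_min lexx orbT.
have He : half_pow eta <= kap by apply: le_trans He0; apply: half_pow_mono; rewrite ge_min lexx.
pose M := half_pow B + 1.
have M0 : 0 < M by rewrite ltr_wpDl// half_pow_ge0.
(* Chosen so that M * (eps / eta ^+ 2) = kap, M being a bound of the weight. *)
pose eps := kap * eta ^+ 2 / M.
have eps0 : 0 < eps by rewrite divr_gt0// mulr_gt0// exprn_gt0.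
have Meps : M * eps = kap * eta ^+ 2 by rewrite /eps mulrC divfK// gt_eqF.
exists (fun t => flat eps 0 (s * t)), (fun t => s * (eps * flat eps 2 (s * t))), s.
split.
  split.
  - move=> j; apply: class_C_flat => // i; apply: class_C_mul; first exact: class_C_cst.
    exact: class_C_coord.
  - move=> t; have D := is_derive_chain (is_derive_mull s (is_derive_id t (1 : R)))
      (is_derive_flat 0 (s * t) eps0).
    by apply: (is_derive_eq D); rewrite mulr0n; ring.
  - move=> t; apply: (@continuousM _ _ (fun=> s) (fun t => eps * flat eps 2 (s * t))).
      exact: cst_continuous.
    apply: (@continuousM _ _ (fun=> eps) (fun t => flat eps 2 (s * t))); first exact: cst_continuous.
    have D := is_derive_chain (is_derive_mull s (is_derive_id t (1 : R)))
      (is_derive_flat 2 (s * t) eps0).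
    exact: is_derive_continuous1 D.
  - by move=> t; rewrite ger0_norm ?flat_ge0// flat0_le1// ltW.
  - by rewrite norm_side.
move=> t tB; have [st|st] := leP (s * t) 0.
  by rewrite /side_weight half_pow_le0// /flat ltNge st /= !mulr0 subr0 normr0 addr0 mulr1 ltW.
rewrite abs_pow_side// /side_weight.
have xB : half_pow (s * t) <= M.
  rewrite /M; apply: le_trans (_ : half_pow B <= _); last by rewrite lerDl.
  by apply: half_pow_mono; apply: le_trans (ler_norm _) _; rewrite normrM norm_side mul1r.
move: (s * t) st xB => x x0 xM; have P0 := half_pow_ge0 x.
split.
  have Ex : 1 - eps / x <= expR (- (eps / x)) by have := expR_ge1Dx (- (eps / x)).
  have E1 : expR (- (eps / x)) <= 1.
    by rewrite -expR0 ler_expR oppr_le0 divr_ge0// ltW.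
  have E0 := expR_ge0 (- (eps / x)).
  rewrite /flat x0 expr0 mul1r; set ee := expR _ in Ex E1 E0 *.
  rewrite -[X in _ - X]mulr1 -mulrBr normrM (ger0_norm P0) distrC ger0_norm ?subr_ge0//.
  have [xe|xe] := leP x eta.
    apply: le_trans He; apply: le_trans (half_pow_mono xe).
    by rewrite -[leRHS]mulr1 ler_wpM2l//; lra.
  apply: le_trans (_ : M * (eps / x) <= _).
    by apply: ler_pM => //; lra.
  rewrite mulrA Meps ler_pdivrMr//; apply: ler_wpM2l; first exact: ltW.
  apply: le_trans (ltW xe); rewrite -[leRHS]mulr1 expr2; apply: ler_wpM2l => //; exact: ltW.
have z0 : 0 <= eps * flat eps 2 x by rewrite mulr_ge0 ?flat_ge0// ltW.
have -> : s * (s * (eps * flat eps 2 x)) = eps * flat eps 2 x by rewrite mulrA ss mul1r.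
rewrite normrM normrM norm_side mul1r (ger0_norm P0) (ger0_norm z0).
have [xe|xe] := leP x eta.
  apply: (@le_trans _ _ (kap * (eps * flat eps 2 x))).
    by apply: ler_wpM2r => //; apply: le_trans He; exact: half_pow_mono.
  by apply: ler_wpM2l; [exact: ltW|rewrite lerDr].
apply: (@le_trans _ _ kap); last first.
  by rewrite -[leLHS]mulr1; apply: ler_wpM2l; [exact: ltW|rewrite lerDl].
apply: le_trans (_ : M * (eps * x^-1 ^+ 2) <= _).
  apply: ler_pM => //; apply: ler_wpM2l; first exact: ltW.
  rewrite /flat x0 -[leRHS]mulr1; apply: ler_wpM2l; first by rewrite exprn_ge0// invr_ge0 ltW.
  by rewrite -expR0 ler_expR oppr_le0 divr_ge0// ltW.
rewrite mulrA Meps exprVn ler_pdivrMr ?exprn_gt0//; apply: ler_wpM2l; first exact: ltW.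
by apply: lerXn2r; rewrite ?nnegrE ltW.
Qed.

End half_line_weight.

Section concentration.
Context {R : realType} {m : nat}.
Notation E := 'rV[R]_m.+1.
Implicit Types x y : E.

Definition set_last x (t : R) : E := \row_i (if i == ord_max then t else x 0 i).

Lemma set_last_last x t : set_last x t 0 ord_max = t.
Proof. by rewrite mxE eqxx. Qed.

Lemma rad_set_last T x s t : rad T (set_last x s) (set_last x t) = T - (t - s) ^+ 2.
Proof.
rewrite /rad (bigD1 ord_max)//= !set_last_last big1 ?addr0// => i /negbTE iN.
by rewrite !mxE iN subrr expr0n.
Qed.

(** If v y were positive, v would be positive on a small ball. *)
Lemma nonpos_of_radial (v : E -> R) y : continuous v ->
  (forall T, Rn_int (fun x => v x * pos_pow 1 (rad T y x)) = 0) -> v y <= 0.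
Proof.
move=> cv H; rewrite leNgt; apply/negP => vy.
have [d d0 Hd] := continuous_dist (cv y) vy.
pose T := (d / 2) ^+ 2.
have d2 : 0 < d / 2 by rewrite divr_gt0.
have : 0 < Rn_int (fun x => v x * pos_pow 1 (rad T y x)).
  apply: (Rn_int_gt0 (p := y)).
  - by apply: CcMl => //; exact: Cc_pos_pow.
  - move=> x; have [r0|r0] := leP (rad T y x) 0; first by rewrite pos_pow_le0// mulr0.
    apply: mulr_ge0; last exact: pos_pow_ge0.
    have : `|v x - v y| < v y.
      apply: Hd; apply: norm_lt_coord => // i; rewrite !mxE.
      have := rad_coord i (ltW r0).
      rewrite -(real_normK (num_real (x 0 i - y 0 i))) /T ler_sqr ?nnegrE ?(ltW d2)//.
      by lra.
    by rewrite ltr_norml; lra.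
  - apply: mulr_gt0 => //.
    have -> : rad T y y = T by rewrite /rad big1 ?subr0// => i _; rewrite subrr expr0n.
    by rewrite pos_pow_ge ?exprn_gt0// ?exprn_ge0// ltW.
by rewrite H ltxx.
Qed.

Lemma bernoulli (z : R) k : 0 <= z -> k%:R * (z - 1) <= z ^+ k - 1.
Proof.
move=> z0; case: k => [|k]; first by rewrite mul0r expr0 subrr.
by have := exprn_tangent k z0 ler01; rewrite !expr1n mulr1.
Qed.

(** Take y the projection of x on the hyperplane and T the square of its distance
b to x. If v x > 0, then v is bounded below by v x / 2 on the cap of the half-ball
where the height is at least q, for some q < b close to b. With z the quotient
of the height by q, the vanishing moments give
0 >= k * (v x / 2) * A - D for all k, where A > 0 is the integral of (z - 1)_+ and
D that of |v|, both against om * r_+: Bernoulli's inequality gives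
z^(2k) >= k (z - 1) on the cap, and z^(2k) <= 1 on the rest of the half-ball. *)
Lemma nonpos_of_moments (om : R -> R) (s : R) (v : E -> R) x :
  s * s = 1 -> continuous om -> (forall t, 0 <= om t) ->
  (forall t, (0 < om t) = (0 < s * t)) -> continuous v -> 0 < s * x 0 ord_max ->
  (forall k T, moment om v (set_last x 0) k 1 T = 0) -> v x <= 0.
Proof.
move=> ss com om0 ompos cv sx H; rewrite leNgt; apply/negP => vx.
set t0 := x 0 ord_max in sx; pose b := s * t0; pose y := set_last x 0.
have eta0 : 0 < v x / 2 by rewrite divr_gt0.
have [d d0 Hd] := continuous_dist (cv x) eta0.
have b0 : 0 < b by [].
(* The bounds on dl ensure that a point of the half-ball with height at least
   q = b - dl is at distance less than d from x. *)
pose dl := Num.min (b / 2) (Num.min (d / 2) (d ^+ 2 / (4 * b))).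
have dl0 : 0 < dl by rewrite !lt_min !divr_gt0// ?exprn_gt0// mulr_gt0.
have dlb : dl <= b / 2 by rewrite ge_min lexx.
have dld : dl <= d / 2 by rewrite !ge_min lexx !orbT.
have dldb : dl <= d ^+ 2 / (4 * b) by rewrite !ge_min lexx !orbT.
have dldb' : dl * (4 * b) <= d ^+ 2 by rewrite -ler_pdivlMr// mulr_gt0.
pose q := b - dl.
have q0 : 0 < q by rewrite /q; lra.
have qb : q < b by rewrite /q; lra.
have bq : b ^+ 2 - q ^+ 2 < d ^+ 2.
  have -> : b ^+ 2 - q ^+ 2 = dl * (2 * b) - dl ^+ 2 by rewrite /q; ring.
  have : 0 < dl ^+ 2 by rewrite exprn_gt0.
  have : 0 <= dl * b by rewrite mulr_ge0// ltW.
  by move: dldb'; lra.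
pose T := b ^+ 2.
pose z x := s * x 0 ord_max / q.
pose F (x : E) := om (x 0 ord_max) * pos_pow 1 (rad T y x).
have hE x' : height y x' = x' 0 ord_max by rewrite /height set_last_last subr0.
have zE x' : z x' ^+ 2 = height y x' ^+ 2 / q ^+ 2.
  rewrite hE /z; have -> : (s * x' 0 ord_max / q) ^+ 2 = s * s * (x' 0 ord_max ^+ 2 / q ^+ 2).
    by field; rewrite gt_eqF.
  by rewrite ss mul1r.
have F0 x' : 0 <= F x' by apply: mulr_ge0 => //; exact: pos_pow_ge0.
have CF : Cc F by apply: CcMl; [exact: continuous_last|exact: Cc_pos_pow].
have cz : continuous z.
  move=> x'; apply: (@continuousM _ _ (fun x : E => s * x 0 ord_max) (fun=> q^-1)); last exact: cst_continuous.
  by apply: (@continuousM _ _ (fun=> s) (fun x : E => x 0 ord_max)); [exact: cst_continuous|exact: coord_continuous].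
have close x' : 0 < F x' -> 1 <= z x' -> v x / 2 <= v x'.
  move=> Fx zx; have rx : 0 < rad T y x'.
    rewrite ltNge; apply/negP => r0; move: Fx.
    by rewrite /F pos_pow_le0// mulr0 ltxx.
  have sq : q <= s * x' 0 ord_max by move: zx; rewrite /z ler_pdivlMr// mul1r.
  have hb : (x' 0 ord_max) ^+ 2 <= T.
    by have := rad_coord ord_max (ltW rx); rewrite set_last_last subr0.
  have sE : (s * x' 0 ord_max) ^+ 2 = (x' 0 ord_max) ^+ 2 by rewrite exprMn expr2 ss mul1r.
  have sb : s * x' 0 ord_max <= b.
    move: hb; rewrite -sE /T ler_sqr// nnegrE; last exact: ltW.
    by apply: le_trans sq; exact: ltW.
  have norms : `|s| = 1 by exact: norm_side.
  have : `|v x' - v x| < v x / 2.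
    apply: Hd; apply: norm_lt_coord => // i; rewrite !mxE.
    have [->|iN] := eqVneq i ord_max.
      rewrite -[ltLHS]mul1r -norms -normrM mulrBr ltr_norml.
      by rewrite -/t0 -/b; move: sq sb; rewrite /q; lra.
    have : (x' 0 i - x 0 i) ^+ 2 < d ^+ 2.
      apply: le_lt_trans bq; move: rx; rewrite /rad (bigD1 ord_max)//= (bigD1 i)//=.
      rewrite set_last_last subr0 [y 0 i]mxE (negbTE iN).
      have : 0 <= \sum_(j | (j != ord_max) && (j != i)) (x' 0 j - y 0 j) ^+ 2.
        by apply: sumr_ge0 => j _; exact: sqr_ge0.
      have : q ^+ 2 <= (x' 0 ord_max) ^+ 2.
        by rewrite -sE; apply: lerXn2r => //; rewrite nnegrE ltW// (lt_le_trans q0).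
      by rewrite /T; lra.
    by rewrite -(real_normK (num_real (x' 0 i - x 0 i))) ltr_sqr// ?nnegrE// ltW.
  by rewrite ltr_norml; lra.
have C1 : Cc (fun x => pos_pow 1 (z x - 1) * F x).
  apply: CcMl => // x'; apply: (@continuous_comp _ _ _ (fun x => z x - 1)); last exact: continuous_pos_pow.
  by apply: (@continuousB _ _ _ z (fun=> 1)); [exact: cz|exact: cst_continuous].
have C2 : Cc (fun x => `|v x| * F x).
  apply: CcMl => // x'; apply: continuous_comp; [exact: cv|exact: norm_continuous].
pose A := Rn_int (fun x => pos_pow 1 (z x - 1) * F x).
pose D := Rn_int (fun x => `|v x| * F x).
have A0 : 0 < A.
  (* A point of the cap at which the integrand of A is positive. *)
  pose t1 := (q + b) / 2.
  have t1q : q < t1 by rewrite /t1; lra.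
  have t1b : t1 < b by rewrite /t1; lra.
  apply: (Rn_int_gt0 (p := set_last x (s * t1))) => //.
    by move=> x'; apply: mulr_ge0 => //; exact: pos_pow_ge0.
  have zt : z (set_last x (s * t1)) = t1 / q by rewrite /z set_last_last mulrA ss mul1r.
  apply: mulr_gt0.
    have z1 : 0 < t1 / q - 1 by rewrite subr_gt0 ltr_pdivlMr// mul1r.
    by rewrite zt pos_pow_ge ?expr1// ltW.
  apply: mulr_gt0; first by rewrite ompos set_last_last mulrA ss mul1r (lt_trans q0).
  have r1 : 0 < rad T y (set_last x (s * t1)).
    rewrite rad_set_last subr0 exprMn expr2 ss mul1r subr_gt0 /T.
    by apply: ltrXn2r => //; rewrite ?nnegrE ltW// (lt_trans q0).
  by rewrite pos_pow_ge ?expr1// ltW.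
have D0 : 0 <= D by apply: Rn_int_ge0 => // x'; apply: mulr_ge0.
have key k : k%:R * (v x / 2 * A) <= D.
  have HA : Rn_int (fun x => (q ^+ 2)^-1 ^+ k * (v x * (om (x 0 ord_max) *
      ((height y x ^+ 2) ^+ k * pos_pow 1 (rad T y x))))) = 0.
    by rewrite Rn_intZ; [rewrite -/(moment om v y k 1 T) H mulr0|exact: Cc_moment].
  rewrite mulrA -Rn_intZ// -subr_le0 -Rn_intB//; last exact: CcZ.
  rewrite -HA; apply: le_Rn_int.
  - by apply: CcB => //; exact: CcZ.
  - by apply: CcZ; exact: Cc_moment.
  move=> x'.
  have -> : (q ^+ 2)^-1 ^+ k * (v x' * (om (x' 0 ord_max) *
      ((height y x' ^+ 2) ^+ k * pos_pow 1 (rad T y x')))) = v x' * (z x' ^+ 2) ^+ k * F x'.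
    by rewrite zE (exprMn _ (height y x' ^+ 2)) /F; ring.
  have zp : 0 < F x' -> 0 < z x'.
    move=> Fx; rewrite /z divr_gt0// -ompos lt_neqAle om0 andbT eq_sym; apply/negP => /eqP o0.
    by move: Fx; rewrite /F o0 mul0r ltxx.
  move: (F0 x') (close x') zp; move: (F x') => f f0 cl zp.
  rewrite (_ : _ - _ = (k%:R * (v x / 2) * pos_pow 1 (z x' - 1) - `|v x'|) * f); last by ring.
  have [Fx|Fx] := leP f 0.
    by rewrite (_ : f = 0) ?mulr0//; apply/eqP; rewrite eq_le Fx f0.
  apply: ler_wpM2r; first exact: ltW.
  have [z1|z1] := leP 1 (z x').
    have vx' := cl Fx z1.
    have vx'0 : 0 <= v x' by apply: le_trans vx'; exact: ltW.
    have zk : k%:R * (z x' - 1) <= (z x' ^+ 2) ^+ k.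
      have := bernoulli k (sqr_ge0 (z x')).
      have : k%:R * (z x' - 1) <= k%:R * (z x' ^+ 2 - 1).
        apply: ler_wpM2l => //; rewrite lerD2r expr2 -[leLHS]mul1r; apply: ler_wpM2r => //.
        exact: le_trans z1.
      by lra.
    rewrite pos_pow_ge ?subr_ge0// expr1.
    apply: le_trans (_ : v x / 2 * (z x' ^+ 2) ^+ k <= _); last first.
      by apply: ler_wpM2r => //; rewrite exprn_ge0// sqr_ge0.
    apply: le_trans (_ : v x / 2 * (k%:R * (z x' - 1)) <= _); last first.
      by apply: ler_wpM2l => //; exact: ltW.
    by rewrite [leRHS]mulrCA [leRHS]mulrA gerBl.
  have {}zp := zp Fx.
  rewrite pos_pow_le0; last by rewrite subr_le0 ltW.
  rewrite mulr0 sub0r.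
  have zk : (z x' ^+ 2) ^+ k <= 1 by rewrite -exprM exprn_ile1// ltW.
  have zk0 : 0 <= (z x' ^+ 2) ^+ k by rewrite exprn_ge0// sqr_ge0.
  rewrite lerNl; apply: le_trans (ler_norm _) _; rewrite normrN normrM (ger0_norm zk0).
  by rewrite -[leRHS]mulr1 ler_wpM2l.
have w0 : 0 < v x / 2 * A by rewrite mulr_gt0.
have := archi_boundP (divr_ge0 D0 (ltW w0)).
by rewrite ltr_pdivrMr// ltNge key.
Qed.

End concentration.

(** * Liouville theorem *)

Section liouville.
Context {R : realType} {m : nat}.
Notation E := 'rV[R]_m.+1.
Variables (a : R) (u : E -> R).
Hypothesis a0 : 0 <= a.
Hypothesis u_C1 : class_C 1 u.
Hypothesis u_pos : forall x, 0 < u x.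
Hypothesis u_weak : forall phi, test_function phi ->
  Rn_int (fun x => \sum_i `|x 0 ord_max| `^ a * partial i u x * partial i phi x) = 0.

Let cu : continuous u. Proof. exact: class_C_continuous u_C1. Qed.

Let cdu i : continuous (partial i u).
Proof. exact: (class_C_partial i u_C1). Qed.

Let ddu i x : is_derive x (delta_mx 0 i) u (partial i u x).
Proof. exact: class_C_is_derive u_C1. Qed.

Lemma moments_opp (om : R -> R) (v : E -> R) y k q T : continuous om -> continuous v ->
  moment om (fun x => -1 * v x) y k q.+1 T = - moment om v y k q.+1 T.
Proof.
move=> com cv; rewrite /moment -[RHS]mulN1r -Rn_intZ; last exact: Cc_moment.
by apply: eq_Rn_int => x; rewrite -!mulrA.
Qed.

Let cuc c : continuous (fun x => u x - c).
Proof.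
move=> x; apply: (@continuousB _ _ _ u (fun=> c)); first exact: cu.
exact: cst_continuous.
Qed.

Let cNuc c : continuous (fun x => -1 * (u x - c)).
Proof.
move=> x; apply: (@continuousM _ _ (fun=> -1) (fun x => u x - c)); last exact: cuc.
exact: cst_continuous.
Qed.

Lemma liouville_unweighted : a = 0 -> exists c, forall x, u x = c.
Proof.
move=> a00; pose om (t : R) : R := 1.
have com : continuous om by move=> t; exact: cst_continuous.
have cw : continuous (fun t : R => `|t| `^ a).
  rewrite (_ : (fun t : R => `|t| `^ a) = (fun=> 1)); first by move=> t; exact: cst_continuous.
  by apply/funext => t; rewrite a00 powRr0.
have cut : @cutoff_limit R m (fun t => `|t| `^ a) om.
  move=> B kap k0; exists (fun=> 1), (fun=> 0), 0; split; last first.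
    move=> t _; rewrite a00 powRr0 !mulr0 addr0 !mulr1 subrr normr0.
    by split; exact: ltW.
  split; [by move=> j; exact: class_C_cst| | |by move=> t; rewrite normr1|by rewrite normr0].
    by move=> t; exact: (is_derive_cst (1 : R) t (1 : R)).
  by move=> t; exact: cst_continuous.
have Ctr y : center a om (fun i => partial i u) y.
  split; last by apply: weak_limit cw com cdu cut u_weak.
  move=> t; have D := is_derive_add (is_derive_id t (1 : R))
    (is_derive_cst (- y 0 ord_max) t (1 : R)).
  rewrite (_ : (fun _ => _) = (fun t => t + - y 0 ord_max)); last first.
    by apply/funext => z; rewrite mul1r.
  by apply: (is_derive_eq D); rewrite a00 !addr0 mulr1.
have [] := moments_vanish a0 com (fun=> ler01) cu (fun x => ltW (u_pos x)) cdu ddu (Ctr 0).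
  apply: (Rn_int_gt0 (p := 0)).
  - by apply: Cc_moment => // x; exact: cst_continuous.
  - by move=> x; rewrite !mul1r pos_pow_ge0.
  - rewrite !mul1r (_ : rad 1 0 0 = 1) ?pos_pow_ge// ?expr1n//.
    by rewrite /rad big1 ?subr0// => i _; rewrite subrr expr0n.
move=> c Hc; exists c => x; apply/eqP; rewrite -subr_eq0 eq_le; apply/andP; split.
  apply: (@nonpos_of_radial _ _ (fun x => u x - c)) => // T.
  have := Hc x (Ctr x) 0%N 0%N T; rewrite /moment => H; rewrite -[RHS]H.
  by apply: eq_Rn_int => z; rewrite !mul1r.
rewrite -oppr_le0 -mulN1r; apply: (@nonpos_of_radial _ _ (fun x => -1 * (u x - c))) => // T.
have := Hc x (Ctr x) 0%N 0%N T => H; rewrite -[RHS]oppr0 -[in RHS]H -moments_opp//.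
by apply: eq_Rn_int => z; rewrite !mul1r.
Qed.

(** The weight om keeps one half-space only, and each point of it is the pole of a
half-ball around a center of the hyperplane. *)
Lemma liouville_half_space (s : R) : 0 < a -> s * s = 1 ->
  exists c, forall x : E, 0 < s * x 0 ord_max -> u x = c.
Proof.
move=> apos ss; pose om := side_weight a s.
have com : continuous om by exact: continuous_side_weight.
have om0 t : 0 <= om t by exact: half_pow_ge0.
have ompos t : (0 < om t) = (0 < s * t).
  have [st|st] := leP (s * t) 0; first by rewrite /om /side_weight half_pow_le0// ltxx.
  by rewrite /om /side_weight half_pow_ge ?powR_gt0// ltW.
have cw : continuous (fun t : R => `|t| `^ a).
  have -> : (fun t : R => `|t| `^ a) = (fun t => half_pow a `|t|).
    by apply/funext => t; rewrite half_pow_ge.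
  move=> t; apply: (@continuous_comp _ _ _ (fun t : R => `|t|)); first exact: norm_continuous.
  exact: continuous_half_pow.
have cut := @cutoff_limit_side R a apos s ss m.
have Ctr (y : E) : y 0 ord_max = 0 -> center a om (fun i => partial i u) y.
  move=> y0; split; last by apply: weak_limit cw com cdu cut u_weak.
  by move=> t; rewrite y0; exact: is_derive_side_weight.
have c1 : continuous (fun _ : E => 1 : R) by move=> x; exact: cst_continuous.
have [||c Hc] := moments_vanish a0 com om0 cu (fun x => ltW (u_pos x)) cdu ddu (y0 := 0).
- by apply: Ctr; rewrite mxE.
- apply: (Rn_int_gt0 (p := set_last 0 (s / 2))).
  + exact: Cc_moment.
  + move=> x; rewrite expr0 !mul1r; apply: mulr_ge0 => //; exact: pos_pow_ge0.
  + have p2 : 0 < s * (s / 2) by rewrite mulrA ss divr_gt0.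
    rewrite expr0 !mul1r; apply: mulr_gt0; first by rewrite ompos set_last_last.
    have {1}-> : (0 : E) = set_last 0 0 by apply/rowP => i; rewrite !mxE; case: ifP.
    rewrite rad_set_last subr0 (_ : (s / 2) ^+ 2 = s * s / 4); last by field.
    by rewrite ss pos_pow_ge ?exprn_gt0//; lra.
exists c => x sx; have Cx : center a om (fun i => partial i u) (set_last x 0).
  by apply: Ctr; rewrite set_last_last.
apply/eqP; rewrite -subr_eq0 eq_le; apply/andP; split.
  by apply: (nonpos_of_moments ss com om0 ompos (cuc (c := c)) sx) => k T; exact: Hc.
rewrite -oppr_le0 -mulN1r.
apply: (nonpos_of_moments ss com om0 ompos (cNuc (c := c)) sx) => k T.
by rewrite moments_opp// Hc// oppr0.
Qed.

(** The points of the hyperplane are limits of points of the open half-space. *)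
Lemma half_space_boundary (s c : R) (x : E) : s * s = 1 ->
  (forall z : E, 0 < s * z 0 ord_max -> u z = c) -> x 0 ord_max = 0 -> u x = c.
Proof.
move=> ss Hc x0; apply/eqP; rewrite -subr_eq0 -normr_eq0.
apply: contraT; rewrite -normr_gt0 normr_id => e0.
have cux : {for x, continuous u} by exact: cu.
have [d d0 Hd] := continuous_dist cux e0.
have d2 : 0 < d / 2 by rewrite divr_gt0.
have := Hd (set_last x (s * (d / 2))).
rewrite (Hc (set_last x _)) => [|]; last by rewrite set_last_last mulrA ss mul1r.
rewrite (distrC c) ltxx; apply.
apply: norm_lt_coord => // i; rewrite !mxE; case: eqP => [->|_]; last by rewrite subrr normr0.
rewrite x0 subr0 normrM (norm_side ss) mul1r gtr0_norm//; lra.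
Qed.

Lemma liouville_weighted : 0 < a -> exists c, forall x, u x = c.
Proof.
move=> apos.
have p1 : 1 * 1 = 1 :> R by rewrite mul1r.
have n1 : -1 * -1 = 1 :> R by rewrite mulrNN mul1r.
have [c Hc] := liouville_half_space apos p1.
have [c' Hc'] := liouville_half_space apos n1.
have b0 : (0 : E) 0 ord_max = 0 by rewrite mxE.
have cc' : c' = c by rewrite -(half_space_boundary n1 Hc' b0) (half_space_boundary p1 Hc b0).
exists c => x; have [xn|xn|xn] := ltgtP (x 0 ord_max) 0.
- by rewrite Hc' ?cc'// mulN1r oppr_gt0.
- by rewrite Hc// mul1r.
- exact: half_space_boundary p1 Hc xn.
Qed.

End liouville.

Theorem corollary1p4 (R : realType) (m : nat) (hm : (2 <= m.+1)%N)
    (a : R) (ha0 : 0 <= a) (ha1 : a < 1)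
    (u : 'rV[R]_m.+1 -> R)
    (u_C2 : class_C 2 u)
    (u_pos : forall x, 0 < u x)
    (u_eq : forall phi, test_function phi ->
       distr_div (fun x => (`|x 0 ord_max| `^ a) *: grad u x) phi = 0%E) :
  exists c : R, forall x, u x = c.
Proof.
have u_weak phi : test_function phi ->
    Rn_int (fun x => \sum_i `|x 0 ord_max| `^ a * partial i u x * partial i phi x) = 0.
  move=> /u_eq /eqP; rewrite /distr_div oppe_eq0 => /eqP H.
  rewrite -[RHS]/(fine (0%E : \bar R)) -H; congr (fine (integral_Rn _)).
  by apply/funext => x; rewrite /dot; apply: eq_bigr => i _; rewrite !mxE.
have u_C1 := class_C_pred u_C2.
have [apos|a00] := ltP 0 a; first exact: (liouville_weighted ha0 u_C1 u_pos u_weak apos).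
apply: (liouville_unweighted ha0 u_C1 u_pos u_weak).
by apply/eqP; rewrite eq_le a00 ha0.
Qed.
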